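(* Assume the root system of $G$ is indecomposable. Then the rationality graph $\Gamma(W)$ is connected. Moreover, if $\epsilon$ denotes the Dynkin diagram automorphism with $w_0(\alpha) = -\epsilon(\alpha)$ for $\alpha \in \Delta$, extended to a group automorphism of $W$ by $\epsilon(s_\alpha) = s_{\epsilon(\alpha)}$, then for every $u \in W$, $u$ is rational if and only if $\epsilon(u)$ is rational (so $\epsilon$ induces an involutive automorphism of $\Gamma(W)$ fixing $w_0$). Finally, $\Gamma(W)$ has more than one vertex if and only if $w_0 \neq -\mathrm{id}$, i.e. if and only if the type is $A_r$ with $r \geq 2$, $D_r$ with $r$ odd, or $E_6$.
   Context: Let $G$ be a connected complex reductive algebraic group with Cartan subgroup $\mathcal{H}$ and Weyl group $W = N_G(\mathcal{H})/\mathcal{H}$; $\Pi$ the roots, $\Delta$ the simple roots, $\Pi_+$ the positive roots, $s_\alpha$ the simple reflections, $w_0$ the longest element. For roots, $\alpha \le \beta$ iff $\beta-\alpha$ is a nonnegative integer combination of simple roots. For $A \subseteq \Pi_+$ let $\mathrm{Adj}(A) = \{\alpha \in \Pi_+ : \exists\beta\in A,\ \alpha\le\beta\}$. For $u\in W$: $\nu^0(u) = u(\Pi_+)\cap\Pi_+$, $\nu^k(u) = u(\mathrm{Adj}\,\nu^{k-1}(u))\cap\Pi_+$; this sequence is descending and eventually constant with eventual value $\nu(u)$; $u$ is rational iff $\nu(u)=\emptyset$. The rationality graph $\Gamma(W)$ has as vertices the rational elements of $W$, with $u$ and $v$ joined by an edge iff $u = s_\alpha v$ for some $\alpha\in\Delta$.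 *)

(* Defs.v *)
(* Root data encoded via a Cartan matrix; roots in simple-root coordinates. *)
From mathcomp Require Import all_boot all_order all_algebra.
Set Implicit Arguments. Unset Strict Implicit. Unset Printing Implicit Defensive.
Import Order.TTheory GRing.Theory Num.Theory.
Local Open Scope ring_scope.

(* Convention: A i j = <alpha_j, alpha_i^vee>, so s_i(alpha_j) = alpha_j - A i j alpha_i. *)

Definition cartan_finite (n : nat) (A : 'M[int]_n) : Prop :=
  [/\ (forall i, A i i = 2),
      (forall i j, i != j -> A i j <= 0),
      (forall i j, A i j = 0 <-> A j i = 0) &
      exists d : 'I_n -> int,
        [/\ (forall i, 0 < d i),
            (forall i j, d i * A i j = d j * A j i) &
            (forall x : 'I_n -> rat, (exists i, x i != 0) ->
               0 < \sum_(i < n) \sum_(j < n) x i * ((d i * A i j)%:~R) * x j)]].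

Definition indecomposable (n : nat) (A : 'M[int]_n) : Prop :=
  (0 < n)%N /\
  forall S : {set 'I_n}, S != set0 -> S != setT ->
    exists i j, [/\ i \in S, j \notin S & A i j != 0].

Definition sref (n : nat) (A : 'M[int]_n) (i : 'I_n) : 'M[int]_n :=
  1%:M - \matrix_(k, j) (if k == i then A i j else 0).

Definition wprod (n : nat) (A : 'M[int]_n) (w : seq 'I_n) : 'M[int]_n :=
  foldr (fun i M => sref A i *m M) 1%:M w.

Definition inW (n : nat) (A : 'M[int]_n) (M : 'M[int]_n) : Prop :=
  exists w, M = wprod A w.

Definition ecol (n : nat) (j : 'I_n) : 'cV[int]_n := delta_mx j 0.

Definition is_root (n : nat) (A : 'M[int]_n) (x : 'cV[int]_n) : Prop :=
  exists M j, inW A M /\ x = M *m ecol j.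

Definition is_posroot (n : nat) (A : 'M[int]_n) (x : 'cV[int]_n) : Prop :=
  is_root A x /\ forall i, 0 <= x i 0.

Definition root_le (n : nat) (x y : 'cV[int]_n) : Prop :=
  forall i, x i 0 <= y i 0.

Definition Adj (n : nat) (A : 'M[int]_n) (P : 'cV[int]_n -> Prop) (y : 'cV[int]_n) : Prop :=
  is_posroot A y /\ exists b, P b /\ root_le y b.

Fixpoint nu (n : nat) (A : 'M[int]_n) (u : 'M[int]_n) (k : nat) : 'cV[int]_n -> Prop :=
  match k with
  | 0 => fun x => is_posroot A x /\ exists y, is_posroot A y /\ x = u *m y
  | k'.+1 => fun x => is_posroot A x /\ exists y, Adj A (nu A u k') y /\ x = u *m y
  end.

(* nu(u) = eventual value; it is empty iff some nu^k(u) is empty (after an empty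
   term the sequence stays empty). *)
Definition rational (n : nat) (A : 'M[int]_n) (u : 'M[int]_n) : Prop :=
  exists k, forall x, ~ nu A u k x.

Definition is_vertex (n : nat) (A : 'M[int]_n) (u : 'M[int]_n) : Prop :=
  inW A u /\ rational A u.

Fixpoint gpath (n : nat) (A : 'M[int]_n) (u : 'M[int]_n) (p : seq 'M[int]_n) : Prop :=
  match p with
  | [::] => True
  | y :: p' => [/\ is_vertex A y, (exists i, y = sref A i *m u) & gpath A y p']
  end.

Definition rgraph_connected (n : nat) (A : 'M[int]_n) : Prop :=
  forall u v, is_vertex A u -> is_vertex A v ->
    exists p, gpath A u p /\ last u p = v.

Definition reduced_word (n : nat) (A : 'M[int]_n) (w : seq 'I_n) : Prop :=
  forall w', wprod A w' = wprod A w -> (size w <= size w')%N.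

Definition longest (n : nat) (A : 'M[int]_n) (w0 : 'M[int]_n) : Prop :=
  exists w, [/\ reduced_word A w, wprod A w = w0 &
    forall v, reduced_word A v -> (size v <= size w)%N].

Definition cartan_of (n : nat) (adj : 'I_n -> 'I_n -> bool) : 'M[int]_n :=
  \matrix_(i, j) (if i == j then 2 else if adj i j then -1 else 0).

Definition adjA (n : nat) (i j : 'I_n) : bool :=
  (i.+1 == j :> nat) || (j.+1 == i :> nat).

(* D_n: path 0 - 1 - ... - (n-2), node n-1 attached to node n-3 *)
Definition adjD (n : nat) (i j : 'I_n) : bool :=
  [&& (i < n.-1)%N, (j < n.-1)%N & (i.+1 == j :> nat) || (j.+1 == i :> nat)]
  || ((i == n.-1 :> nat) && (j == subn n 3 :> nat))
  || ((j == n.-1 :> nat) && (i == subn n 3 :> nat)).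

(* E_6: path 0 - 1 - 2 - 3 - 4, node 5 attached to node 2 *)
Definition adjE6 (n : nat) (i j : 'I_n) : bool :=
  [&& (i < 5)%N, (j < 5)%N & (i.+1 == j :> nat) || (j.+1 == i :> nat)]
  || ((i == 5 :> nat) && (j == 2 :> nat))
  || ((j == 5 :> nat) && (i == 2 :> nat)).

Definition cartan_iso (n : nat) (A B : 'M[int]_n) : Prop :=
  exists s : 'I_n -> 'I_n, bijective s /\ forall i j, A (s i) (s j) = B i j.

Definition special_type (n : nat) (A : 'M[int]_n) : Prop :=
  [\/ (2 <= n)%N /\ cartan_iso A (cartan_of (@adjA n)),
      [&& odd n & 3 <= n]%N /\ cartan_iso A (cartan_of (@adjD n)) |
      n = 6%N /\ cartan_iso A (cartan_of (@adjE6 n))].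

(* Main.v *)
(* Write v = u^-1 and P = {b > 0 : v b > 0}.  Then u is rational iff there are no arbitrarily long
   chains b_0, b_1, ... in P with v b_k <= b_(k+1).  If u <> w0 is rational, some simple root a has
   v a > 0 and u a < 0: otherwise chains in P could be prolonged backwards forever.  For such an a,
   s_a u is again rational.  Indeed a chain for s_a u is a sequence d_k in P with
   v d_k <= s_a d_(k+1); replacing v d_k by the bottom of its a-string, which amounts to adding
   multiples of - u a > 0 to d_k, gives a chain for u, because the bottom of the a-string of a root
   x <= y lies below s_a y.  Iterating leads from u to w0 in the graph.  If w0 = -1, the last step
   would start at u = s_a w0, where u a = a > 0, so w0 is the only vertex; if eps a <> a, then
   s_a w0 is a second one.

   If eps is not trivial, the Dynkin diagram is A_n, D_n or E_6, since any other diagram with an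
   involution carries a nonzero nonnegative vector on whose support the Cartan matrix is
   nonpositive.  Finally, W acts trivially on weights modulo roots, so eps acts there as -1; this
   excludes D_n with n even, and shows w0 <> -1 in the remaining types. *)
Require Import Defs.
From Stdlib Require Import Classical.
From mathcomp Require Import all_boot all_order all_algebra.
From mathcomp Require Import zify ring.
Set Implicit Arguments. Unset Strict Implicit. Unset Printing Implicit Defensive.
Import Order.TTheory GRing.Theory Num.Theory.
Local Open Scope ring_scope.

(** Roots are given only as integer vectors in the orbit of the simple ones, so sign coherence has
    to be proved before strings and the root order can be used. The walk to [w0] ends because each
    step shortens a word for [u^-1 w0]: if [u^-1 a > 0], then [u^-1 w0] makes the simple root
    [eps a] negative.

    On the diagram side, the excluding vectors are typically null vectors of affine diagrams, and no
    list of finite types is consulted. A known piece of the diagram carries a weight that is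
    subharmonic except at its ends, where the excess is at most the weight itself. A second new
    neighbour, a multiple edge or a cycle at an end would absorb this excess and give an excluding
    vector; hence the piece grows by simple edges only, and the weight continues with the same
    value. The diagram alone cannot separate even from odd [n] in type [D_n], since the two prongs
    can always be interchanged; this is why weights modulo roots are brought in. *)

Section FiniteCartan.

Variables (n : nat) (A : 'M[int]_n) (d : 'I_n -> int).
Hypothesis A_diag : forall i, A i i = 2.
Hypothesis A_off : forall i j, i != j -> A i j <= 0.
Hypothesis A_zero : forall i j, A i j = 0 <-> A j i = 0.
Hypothesis d_gt0 : forall i, 0 < d i.
Hypothesis dA_sym : forall i j, d i * A i j = d j * A j i.
Hypothesis dA_pos : forall x : 'I_n -> rat, (exists i, x i != 0) ->
  0 < \sum_(i < n) \sum_(j < n) x i * ((d i * A i j)%:~R) * x j.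

Implicit Types (i j k : 'I_n) (x y z : 'cV[int]_n) (M g u : 'M[int]_n) (w : seq 'I_n).

(** * Coroots and simple reflections in coordinates *)

Definition coroot i x : int := (A *m x) i 0.

Lemma corootE i x : coroot i x = \sum_j A i j * x j 0.
Proof. by rewrite /coroot mxE. Qed.

Lemma corootD i x y : coroot i (x + y) = coroot i x + coroot i y.
Proof. by rewrite /coroot mulmxDr mxE. Qed.

Lemma corootN i x : coroot i (- x) = - coroot i x.
Proof. by rewrite /coroot mulmxN mxE. Qed.

Lemma corootB i x y : coroot i (x - y) = coroot i x - coroot i y.
Proof. by rewrite corootD corootN. Qed.

Lemma corootZ i c x : coroot i (c *: x) = c * coroot i x.
Proof. by rewrite /coroot -scalemxAr mxE. Qed.

Lemma coroot_ecol i j : coroot i (ecol j) = A i j.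
Proof. by rewrite /coroot /ecol -colE mxE. Qed.

Lemma ecolE i j : ecol j i 0 = (i == j)%:R.
Proof. by rewrite mxE eqxx andbT. Qed.

Lemma ecol_inj : injective (@ecol n).
Proof.
by move=> i j /colP /(_ i); rewrite !ecolE eqxx; case: eqP => // _ /eqP; rewrite eq_sym oner_eq0.
Qed.

Lemma sref_mul i x : sref A i *m x = x - coroot i x *: ecol i.
Proof.
rewrite /sref mulmxBl mul1mx; congr (_ - _); apply/colP => k.
rewrite !mxE eqxx andbT; case: (k =P i) => [->|/eqP/negPf ki].
  by rewrite mulr1 corootE; apply: eq_bigr => j _; rewrite mxE eqxx.
by rewrite mulr0 big1 // => j _; rewrite mxE ki mul0r.
Qed.

Lemma col_expand x : x = \sum_j x j 0 *: ecol j.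
Proof.
apply/colP => k; rewrite summxE (bigD1 k) //= mxE ecolE eqxx mulr1 big1 ?addr0 //.
by move=> j /negPf jk; rewrite mxE ecolE eq_sym jk mulr0.
Qed.

Lemma mul_expand M x : M *m x = \sum_j x j 0 *: (M *m ecol j).
Proof. by rewrite {1}[x]col_expand mulmx_sumr; apply: eq_bigr => j _; rewrite scalemxAr. Qed.

Lemma eq_on_ecol M N : (forall j, M *m ecol j = N *m ecol j) -> M = N.
Proof.
move=> h; apply/matrixP => i j.
by have /colP/(_ i) := h j; rewrite /ecol -!colE !mxE.
Qed.

(** * The invariant form *)

Definition form x y : int := \sum_i x i 0 * (d i * coroot i y).

Lemma formDr x y z : form x (y + z) = form x y + form x z.
Proof. by rewrite -big_split; apply: eq_bigr => i _; rewrite corootD !mulrDr. Qed.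

Lemma formZr c x y : form x (c *: y) = c * form x y.
Proof. by rewrite mulr_sumr; apply: eq_bigr => i _; rewrite corootZ; ring. Qed.

Lemma form_sym x y : form x y = form y x.
Proof.
have E (a b : 'cV_n) : form a b = \sum_i \sum_j a i 0 * (d i * A i j) * b j 0.
  apply: eq_bigr => i _; rewrite corootE !mulr_sumr.
  by apply: eq_bigr => j _; rewrite !mulrA.
rewrite !E exchange_big; apply: eq_bigr => i _; apply: eq_bigr => j _.
by rewrite dA_sym; ring.
Qed.

Lemma formNr x y : form x (- y) = - form x y.
Proof. by rewrite -scaleN1r formZr mulN1r. Qed.

Lemma formBr x y z : form x (y - z) = form x y - form x z.
Proof. by rewrite formDr formNr. Qed.

Lemma formDl x y z : form (x + y) z = form x z + form y z.
Proof. by rewrite ![form _ z]form_sym formDr. Qed.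

Lemma formZl c x y : form (c *: x) y = c * form x y.
Proof. by rewrite ![form _ y]form_sym formZr. Qed.

Lemma formNl x y : form (- x) y = - form x y.
Proof. by rewrite ![form _ y]form_sym formNr. Qed.

Lemma formBl x y z : form (x - y) z = form x z - form y z.
Proof. by rewrite ![form _ z]form_sym formBr. Qed.

Lemma form_ecoll i x : form (ecol i) x = d i * coroot i x.
Proof.
rewrite /form (bigD1 i) //= ecolE eqxx mul1r big1 ?addr0 // => j /negPf ji.
by rewrite ecolE ji mul0r.
Qed.

Lemma form_ecol i j : form (ecol i) (ecol j) = d i * A i j.
Proof. by rewrite form_ecoll coroot_ecol. Qed.

Lemma form_pos x : x != 0 -> 0 < form x x.
Proof.
move=> x0; have [i xi] : exists i, x i 0 != 0.
  apply/existsP; apply: contraNT x0 => /existsPn h; apply/eqP/colP => i.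
  by rewrite mxE; have := h i; rewrite negbK => /eqP.
have := @dA_pos (fun i => (x i 0)%:~R) _; have ex : exists i, ((x i 0)%:~R : rat) != 0.
  by exists i; rewrite intr_eq0.
move=> /(_ ex); rewrite -(ltr_int rat) => /lt_le_trans; apply.
rewrite /form rmorph_sum /= ler_sum // => k _.
rewrite corootE !mulr_sumr rmorph_sum /= ler_sum // => j _.
by rewrite !rmorphM /= !mulrA.
Qed.

Lemma form_le0 x : form x x <= 0 -> x = 0.
Proof. by move=> h; apply/eqP; apply: contraTT h => /form_pos; rewrite -ltNge. Qed.

Lemma form_sref i x y : form (sref A i *m x) (sref A i *m y) = form x y.
Proof.
rewrite !sref_mul !(formBl, formBr, formZl, formZr) form_ecol A_diag.
by rewrite [form x (ecol i)]form_sym !form_ecoll; ring.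
Qed.

(** * The Weyl group *)

Lemma sref_ecol i : sref A i *m ecol i = - ecol i.
Proof. by rewrite sref_mul coroot_ecol A_diag scaler_nat mulr2n opprD addrA subrr add0r. Qed.

Lemma srefK i : sref A i *m sref A i = 1%:M.
Proof.
apply: eq_on_ecol => j; rewrite -mulmxA mul1mx [sref A i *m ecol j]sref_mul.
by rewrite mulmxBr -scalemxAr sref_ecol sref_mul scalerN opprK addrNK.
Qed.

Lemma wprod_cat w1 w2 : wprod A (w1 ++ w2) = wprod A w1 *m wprod A w2.
Proof. by elim: w1 => [|i w1 IH] /=; rewrite ?mul1mx // IH mulmxA. Qed.

Lemma wprod_rcons w i : wprod A (rcons w i) = wprod A w *m sref A i.
Proof. by rewrite -cats1 wprod_cat /= mulmx1. Qed.

Lemma wprod_revK w : wprod A w *m wprod A (rev w) = 1%:M.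
Proof.
elim: w => [|i w IH]; rewrite ?mul1mx // rev_cons wprod_rcons /=.
by rewrite -mulmxA [wprod A w *m (_ *m _)]mulmxA IH mul1mx srefK.
Qed.

Lemma inW_unit M : inW A M -> M \in unitmx.
Proof. by case=> w ->; have [] := mulmx1_unit (wprod_revK w). Qed.

Lemma inW_mul M N : inW A M -> inW A N -> inW A (M *m N).
Proof. by move=> [w ->] [w' ->]; exists (w ++ w'); rewrite wprod_cat. Qed.

Lemma inW_sref i : inW A (sref A i).
Proof. by exists [:: i]; rewrite /= mulmx1. Qed.

Lemma inW_1 : inW A 1%:M.
Proof. by exists [::]. Qed.

Lemma inW_inv M : inW A M -> inW A (invmx M).
Proof.
move=> hM; have uM := inW_unit hM; case: hM uM => w -> uM; exists (rev w).
by rewrite -[RHS](mulKmx uM) wprod_revK mulmx1.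
Qed.

Lemma form_inW M x y : inW A M -> form (M *m x) (M *m y) = form x y.
Proof.
case=> w ->; elim: w => [|i w IH] /=; first by rewrite !mul1mx.
by rewrite -!mulmxA form_sref.
Qed.

(** [M s_i M^-1] is the reflection in [M e_i = c e_j]. Both signs occur: [c = 1] in the exchange
    argument, [c = -1] for [w0]. Invariance of the form gives [d i = d j], then equality of the
    coroots. *)
Lemma inW_conj_sref M i j c : inW A M -> M *m ecol i = c *: ecol j -> c * c = 1 ->
  M *m sref A i = sref A j *m M.
Proof.
move=> hM Mi cc; apply: eq_on_ecol => k; rewrite -!mulmxA !sref_mul mulmxBr -scalemxAr Mi.
congr (_ - _); rewrite scalerA; congr (_ *: _).
have dij : d i = d j.
  have := form_inW (ecol i) (ecol i) hM; rewrite Mi formZl formZr !form_ecol !A_diag mulrA cc.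
  by lia.
have := form_inW (ecol i) (ecol k) hM.
rewrite Mi formZl !form_ecoll dij mulrCA => /(mulfI (lt0r_neq0 (d_gt0 j))) <-.
by rewrite mulrC mulrA cc mul1r.
Qed.

(** * Roots *)

Lemma root_ecol i : is_root A (ecol i).
Proof. by exists 1%:M, i; rewrite mul1mx; split=> //; exact: inW_1. Qed.

Lemma root_mul M x : inW A M -> is_root A x -> is_root A (M *m x).
Proof.
by move=> hM [N [j [hN ->]]]; exists (M *m N), j; rewrite mulmxA; split=> //; exact: inW_mul.
Qed.

Lemma root_opp x : is_root A x -> is_root A (- x).
Proof.
move=> [N [j [hN ->]]]; exists (N *m sref A j), j; split; first exact/inW_mul/inW_sref.
by rewrite -mulmxA sref_ecol mulmxN.
Qed.

Lemma root_neq0 x : is_root A x -> x != 0.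
Proof.
move=> [N [j [hN ->]]]; apply: contraTneq isT => E.
have := form_inW (ecol j) (ecol j) hN.
rewrite E form_ecol A_diag -[0](scale0r 0) formZl mul0r; have := d_gt0 j; lia.
Qed.

(** [k] is the Cartan integer of [x] against [y], described through the form because [coroot] is
    indexed by simple roots; it is found by carrying [y] back to a simple root. *)
Lemma root_reflect y x : is_root A y ->
  exists k : int, form y y * k = 2 * form y x /\ (is_root A x -> is_root A (x - k *: y)).
Proof.
move=> [M [j [hM ->]]]; exists (coroot j (invmx M *m x)); split.
  rewrite form_inW // form_ecol A_diag -[x in RHS](mulKVmx (inW_unit hM)) form_inW //.
  by rewrite form_ecoll; ring.
move=> hx; have := root_mul (inW_mul hM (inW_mul (inW_sref j) (inW_inv hM))) hx.
by rewrite -!mulmxA sref_mul mulmxBr (mulKVmx (inW_unit hM)) -scalemxAr.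
Qed.

(** If neither Cartan integer of the pair is 1, both are at least 2, so [form x y] dominates both
    norms and [x - y] has norm at most 0. *)
Lemma root_sub x y : is_root A x -> is_root A y -> x != y -> 0 < form x y ->
  is_root A (x - y).
Proof.
move=> hx hy xy pos; have [k [Ek hk]] := root_reflect x hy.
have [l [El hl]] := root_reflect y hx.
have x_gt0 := form_pos (root_neq0 hx); have y_gt0 := form_pos (root_neq0 hy).
rewrite [form y x]form_sym in Ek.
have k_gt0 : 0 < k by rewrite -(pmulr_rgt0 _ y_gt0) Ek; lia.
have l_gt0 : 0 < l by rewrite -(pmulr_rgt0 _ x_gt0) El; lia.
have [k1|k1] := eqVneq k 1; first by have := hk hx; rewrite k1 scale1r.
have [l1|l1] := eqVneq l 1.
  by have := root_opp (hl hy); rewrite l1 scale1r opprB.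
suff /eqP : x - y = 0 by rewrite subr_eq0 (negPf xy).
apply: form_le0; rewrite !(formBl, formBr) [form y x]form_sym.
suff : form y y <= form x y /\ form x x <= form x y by lia.
by split; nia.
Qed.

Lemma form_root_coroot x i : form x (ecol i) = d i * coroot i x.
Proof. by rewrite form_sym form_ecoll. Qed.

Lemma root_sub_ecol x i : is_root A x -> 0 < coroot i x -> x != ecol i -> is_root A (x - ecol i).
Proof.
move=> hx pos xi; apply: root_sub => //; first exact: root_ecol.
by rewrite form_root_coroot pmulr_rgt0.
Qed.

Lemma root_add_ecol x i : is_root A x -> coroot i x < 0 -> x != - ecol i -> is_root A (x + ecol i).
Proof.
move=> hx neg xi; rewrite -[x + _]opprK; apply: root_opp; rewrite opprD.
by apply: root_sub_ecol; [exact: root_opp | rewrite corootN; lia | rewrite -eqr_opp opprK].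
Qed.

Definition nonneg x := forall i, 0 <= x i 0.

Lemma nonneg_mul M x : nonneg x -> (forall j, 0 < x j 0 -> nonneg (M *m ecol j)) -> nonneg (M *m x).
Proof.
move=> hx hM i; rewrite mul_expand summxE sumr_ge0 // => j _; rewrite mxE.
have := hx j; rewrite le_eqVlt => /orP [/eqP <-|xj]; first by rewrite mul0r.
by rewrite mulr_ge0 ?hM ?hx.
Qed.

Lemma nonneg_ecol i : nonneg (ecol i).
Proof. by move=> j; rewrite ecolE; case: eqP. Qed.

Lemma nonneg_anti x : nonneg x -> nonneg (- x) -> x = 0.
Proof. move=> h1 h2; apply/colP => i; have := h1 i; have := h2 i.
by rewrite !mxE; move: (x i 0) => t; lia. Qed.

Lemma root_nonneg_anti x : is_root A x -> nonneg x -> nonneg (- x) -> False.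
Proof. by move=> /root_neq0/eqP h h1 h2; apply: h; apply: nonneg_anti. Qed.

(** Elements of [W] have integral inverses: pulling back gives [ecol j] as [c] times an integral
    vector, so [c] divides 1. *)
Lemma root_multiple c i : 0 <= c -> is_root A (c *: ecol i) -> c = 1.
Proof.
move=> c0 [M [j [hM E]]].
have : ecol j = c *: (invmx M *m ecol i) by rewrite -(mulKmx (inW_unit hM) (ecol j)) -E scalemxAr.
move=> /colP /(_ j); rewrite ecolE eqxx mxE mulr1n; move: (_ j 0) => m Em.
have m0 : 0 < m by nia.
nia.
Qed.

(** If [a] and [b] had opposite signs, both terms of [2 = a k_i + b k_j] would be positive and the
    first at least 2. *)
Lemma rank2_sign M i j a b : inW A M -> i != j -> M *m ecol i = a *: ecol i + b *: ecol j ->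
  (0 <= a /\ 0 <= b) \/ (a <= 0 /\ b <= 0).
Proof.
move=> hM ij E.
(* The coroot of the root [M *m ecol i]. *)
pose k x := coroot i (invmx M *m x).
have kE : 2 = a * k (ecol i) + b * k (ecol j).
  have := coroot_ecol i i; rewrite A_diag => <-.
  rewrite -[ecol i in LHS](mulKmx (inW_unit hM)) E /k mulmxDr corootD -!scalemxAr.
  by rewrite !corootZ.
have fE x : d i * k x = form (M *m ecol i) x.
  by rewrite -[x in RHS](mulKVmx (inW_unit hM)) form_inW // form_ecoll.
have := fE (ecol i); have := fE (ecol j); rewrite E !(formDl, formZl) !form_ecol !A_diag.
have := dA_sym i j; have := d_gt0 i; have := d_gt0 j; have := A_off ij.
have := A_off (i := j) (j := i); rewrite eq_sym => /(_ ij).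
move: kE; move: (k _) (k _) => ki kj kE Aji Aij dj di dd fj fi.
case: (ltrgt0P a) => a0; case: (ltrgt0P b) => b0; try (by [left; lia | right; lia]).
  have : 0 < ki by nia.
  have : kj < 0 by nia.
  nia.
have : ki < 0 by nia.
have : 0 < kj by nia.
nia.
Qed.


(** * Exchange and sign coherence *)

(** Where the sign changes, the root is the simple root [ecol t], and the letter [t] cancels against
    [i]. The predicate [P] lets this serve twice: inside the proof of coherence, where only two
    letters are under control, and afterwards for all words. *)
Lemma exchange_word (P : pred 'I_n) i :
  (forall w, all P w -> nonneg (wprod A w *m ecol i) \/ nonneg (- (wprod A w *m ecol i))) ->
  forall w, all P w -> nonneg (- (wprod A w *m ecol i)) ->
  exists w', [/\ all P w', (size w' < size w)%N & wprod A w' = wprod A w *m sref A i].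
Proof.
move=> coh; elim=> [_ /(_ i)|t w IH /= /andP [Pt Pw]].
  by rewrite /= mul1mx mxE ecolE eqxx.
rewrite -mulmxA => neg.
have [pos|/(IH Pw) [w' [Pw' sw' Ew']]] := coh w Pw; last first.
  by exists (t :: w'); rewrite /= Pt Pw' ltnS Ew' mulmxA.
exists w; split=> //=; move Dx: (wprod A w *m ecol i) neg pos => x neg pos.
have Ex : x = x t 0 *: ecol t.
  apply/colP => j; rewrite mxE ecolE; have [->|jt] := eqVneq j t; first by rewrite mulr1.
  have := neg j; have := pos j; rewrite sref_mul !mxE eqxx andbT (negPf jt) !mulr0 subr0.
  by move: (x j 0) => c; lia.
have x1 : x t 0 = 1.
  by apply: (@root_multiple _ t); rewrite ?pos // -Ex -Dx; apply: root_mul (root_ecol i); exists w.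
have hw : inW A (wprod A w) by exists w.
rewrite -[RHS]mulmxA (@inW_conj_sref _ i t 1) ?mulr1 //; first by rewrite mulmxA srefK mul1mx.
by rewrite Dx Ex x1.
Qed.

Lemma minimal_word M s : (forall w, wprod A w = M -> (s <= size w)%N) \/
  exists2 w, wprod A w = M & (size w < s)%N.
Proof.
have [h|h] := classic (exists2 w, wprod A w = M & (size w < s)%N); [by right | left=> w Ew].
by rewrite leqNgt; apply/negP => lt; apply: h; exists w.
Qed.

Lemma reduced_exists w : exists2 w', reduced_word A w' & wprod A w' = wprod A w.
Proof.
have [m] := ubnP (size w); elim: m w => // m IH w sw.
have [h|[w' E lt]] := minimal_word (wprod A w) (size w); first by exists w.
by have [w2 h2 E2] := IH w' (leq_trans lt sw); exists w2; rewrite ?E2.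
Qed.

(* Humphreys' argument: split off the part of [w] lying in the dihedral subgroup of [i] and the
   last letter [j]; the remaining left factor is shorter and sends both simple roots to positive
   ones. *)
Lemma reduced_nonneg w i : reduced_word A w ->
  (forall w', wprod A w' = wprod A w *m sref A i -> (size w <= size w')%N) ->
  nonneg (wprod A w *m ecol i).
Proof.
have [m] := ubnP (size w); elim: m w i => // m IHm w i sw red longer.
case/lastP: w sw red longer => [|w1 j] sw red longer.
  by rewrite /= mul1mx; exact: nonneg_ecol.
have ij : i != j.
  apply/eqP => ij; have := longer w1; rewrite wprod_rcons ij -mulmxA srefK mulmx1.
  by move=> /(_ erefl); rewrite size_rcons ltnn.
pose P : pred 'I_n := pred2 i j; set w := rcons w1 j in sw red longer *.
(* [w = v v'] with [v'] in the letters [i], [j] and no excess length; [s] bounds the length of [v],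
   which is to become minimal. *)
suff H s : forall v v' : seq 'I_n, (size v < s)%N -> (size v < size w)%N -> all P v' ->
    wprod A v *m wprod A v' = wprod A w -> (size v + size v' <= size w)%N ->
    nonneg (wprod A w *m ecol i).
  have sz : size w = (size w1).+1 by rewrite size_rcons.
  apply: (H (size w) w1 [:: j]); rewrite ?sz ?addn1 ?wprod_rcons /= ?mulmx1 //.
  by rewrite /P /= eqxx orbT.
elim: s => // s IHs v v' sv lt Pv' E szE.
have redv : reduced_word A v.
  move=> t Et; have := red (t ++ v'); rewrite wprod_cat Et E => /(_ erefl).
  by rewrite size_cat; lia.
have [[k [Pk [t [Et st]]]]|noshort] := classic (exists k, P k /\
    exists t, wprod A t = wprod A v *m sref A k /\ (size t < size v)%N).
  apply: (IHs t (k :: v')); rewrite /= ?Pv' ?andbT //; try lia.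
  by rewrite Et -E -!mulmxA; congr (_ *m _); rewrite mulmxA srefK mul1mx.
have posv k : P k -> nonneg (wprod A v *m ecol k).
  move=> Pk; apply: IHm => //; first by lia.
  move=> t Et; rewrite leqNgt; apply/negP => st.
  by apply: noshort; exists k; split=> //; exists t.
have span t : all P t -> exists a b, wprod A t *m ecol i = a *: ecol i + b *: ecol j.
  elim: t => [|k t IHt] /=; first by exists 1, 0; rewrite mul1mx scale1r scale0r addr0.
  move=> /andP [/pred2P Pt /IHt [a [b E2]]]; rewrite -mulmxA E2 sref_mul.
  set c := coroot _ _; case: Pt => ->.
    by exists (a - c), b; rewrite scalerBl addrAC.
  by exists a, (b - c); rewrite scalerBl addrA.
have coh t : all P t -> nonneg (wprod A t *m ecol i) \/ nonneg (- (wprod A t *m ecol i)).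
  move=> /span [a [b E2]].
  have [|[a0 b0]|[a0 b0]] := rank2_sign _ ij E2; first by exists t.
    by left=> k; rewrite E2 !mxE; lia.
  by right=> k; rewrite E2 !mxE; lia.
(* A positive [v' e_i] combines [e_i] and [e_j], which [v] keeps positive; a negative one makes
   [v' s_i] shorter than [v'], against [longer]. *)
have [pos|neg] := coh v' Pv'.
  rewrite -E -mulmxA; have [a [b E2]] := span v' Pv'.
  apply: nonneg_mul => // k; rewrite E2 !mxE.
  have [->|ki] := eqVneq k i; first by move=> _; apply: posv; rewrite /P /= eqxx.
  have [->|kj] := eqVneq k j; first by move=> _; apply: posv; rewrite /P /= eqxx orbT.
  by rewrite !mulr0.
have [t [_ st Et]] := exchange_word coh Pv' neg.
have := longer (v ++ t); rewrite wprod_cat Et mulmxA E => /(_ erefl).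
by rewrite size_cat; lia.
Qed.

(** Either [w] or a reduced word for [w s_j] is not shortened by [s_j], and the two images of [e_j]
    are opposite. *)
Lemma root_sign x : is_root A x -> nonneg x \/ nonneg (- x).
Proof.
move=> [M [j [[w0 ->] ->]]]; have [w red <-] := reduced_exists w0.
have [longer|[w' E lt]] := minimal_word (wprod A w *m sref A j) (size w).
  by left; exact: reduced_nonneg.
have [t redt Et] := reduced_exists w'.
have st : (size t < size w)%N by apply: leq_ltn_trans lt; apply: redt.
right; have : nonneg (wprod A t *m ecol j).
  apply: reduced_nonneg => // v; rewrite Et E -mulmxA srefK mulmx1 => /red sv.
  exact: ltnW (leq_trans st sv).
by rewrite Et E -mulmxA sref_ecol mulmxN.
Qed.

Lemma inW_exchange w i : nonneg (- (wprod A w *m ecol i)) ->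
  exists2 w', (size w' < size w)%N & wprod A w' = wprod A w *m sref A i.
Proof.
move=> neg; have [||w' [_ sw' Ew']] := @exchange_word xpredT i _ w _ neg.
- by move=> t _; apply: root_sign; apply: root_mul (root_ecol i); exists t.
- by rewrite all_predT.
by exists w'.
Qed.

(** If [v i] is a word for [M], then [v e_i = - M e_i] is negative, so exchange shortens the
    word. *)
Lemma inW_nonneg_id M : inW A M -> (forall i, nonneg (M *m ecol i)) -> M = 1%:M.
Proof.
move=> [w ->]; have [m] := ubnP (size w); elim: m w => // m IH w.
case: (lastP w) => // v i; rewrite size_rcons wprod_rcons => sw pos.
have neg : nonneg (- (wprod A v *m ecol i)) by rewrite -mulmxN -sref_ecol mulmxA.
have [t st Et] := inW_exchange neg.
by rewrite -Et; apply: IH => [|j]; rewrite ?Et //; lia.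
Qed.

(** * Root strings and the root order *)

Lemma posroot_ecol i : is_posroot A (ecol i).
Proof. by split; [exact: root_ecol | exact: nonneg_ecol]. Qed.

Lemma posroot_supp x i : is_posroot A x -> (forall j, j != i -> x j 0 = 0) -> x = ecol i.
Proof.
move=> [rx px] h; have E : x = x i 0 *: ecol i.
  apply/colP => j; rewrite [RHS]mxE ecolE; case: eqVneq => [->|/h ->]; by rewrite ?mulr1 ?mulr0.
by rewrite E (@root_multiple (x i 0) i) ?scale1r // -E.
Qed.

Lemma posroot_other x i : is_posroot A x -> x != ecol i -> exists2 j, j != i & 0 < x j 0.
Proof.
move=> hx xi; suff /existsP [j /andP [ji xj]] : [exists j, (j != i) && (0 < x j 0)] by exists j.
apply: contraNT xi => /existsPn h; apply/eqP/posroot_supp => // j ji.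
have := h j; rewrite ji /= -leNgt => xj; apply/eqP; rewrite eq_le xj; exact: hx.2.
Qed.

Lemma posroot_coord x j : is_root A x -> 0 < x j 0 -> is_posroot A x.
Proof.
move=> rx xj; split=> //; case: (root_sign rx) => // /(_ j).
by rewrite mxE oppr_ge0 leNgt xj.
Qed.

(** A positive root other than [ecol i] has a positive coordinate off [i]; moving along the
    [i]-string keeps it, and sign coherence does the rest. *)
Lemma posroot_same_coords x y i : is_posroot A x -> x != ecol i -> is_root A y ->
  (forall j, j != i -> y j 0 = x j 0) -> is_posroot A y.
Proof.
move=> hx xi ry E; have [j ji xj] := posroot_other hx xi.
by apply: (@posroot_coord _ j); rewrite ?E.
Qed.

Lemma coord_sub_ecol x c i j : j != i -> (x - c *: ecol i) j 0 = x j 0.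
Proof. by move=> /negPf ji; rewrite mxE [X in _ + X]mxE mxE ecolE ji mulr0 subr0. Qed.

Lemma coord_sub_ecol_eq x c i : (x - c *: ecol i) i 0 = x i 0 - c.
Proof. by rewrite mxE [X in _ + X]mxE mxE ecolE eqxx mulr1. Qed.

Lemma posroot_shift x i c : is_posroot A x -> x != ecol i -> is_root A (x - c *: ecol i) ->
  is_posroot A (x - c *: ecol i).
Proof. by move=> hx xi ry; apply: posroot_same_coords hx xi ry _ => j; exact: coord_sub_ecol. Qed.

Lemma posroot_sref x i : is_posroot A x -> x != ecol i -> is_posroot A (sref A i *m x).
Proof.
move=> hx xi; have := root_mul (inW_sref i) hx.1; rewrite sref_mul; exact: posroot_shift.
Qed.

(** If neither root admits the other subtraction, [form (y - ecol i) (y - ecol j)] is at least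
    [form y y - form (ecol i) (ecol j) > 0]; then the difference [ecol j - ecol i] would be a root,
    of mixed signs. *)
Lemma root_sub2 y i j : y != 0 -> i != j -> is_root A (y - ecol i) -> is_root A (y - ecol j) ->
  is_root A (y - ecol i - ecol j) \/ y = ecol i + ecol j.
Proof.
move=> y0 ij ri rj.
have [E|ne1] := eqVneq (y - ecol i) (ecol j); first by right; rewrite -E addrC addrNK.
have [E|ne2] := eqVneq (y - ecol j) (ecol i); first by right; rewrite -E addrNK.
have [h1|h1] := ltrP 0 (coroot j (y - ecol i)); first by left; exact: root_sub_ecol.
have [h2|h2] := ltrP 0 (coroot i (y - ecol j)).
  by left; rewrite addrAC; exact: root_sub_ecol.
have pos : 0 < form (y - ecol i) (y - ecol j).
  have f1 : form (y - ecol i) (ecol j) <= 0 by rewrite form_root_coroot; have := d_gt0 j; nia.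
  have f2 : form (y - ecol j) (ecol i) <= 0 by rewrite form_root_coroot; have := d_gt0 i; nia.
  have f3 : form (ecol i) (ecol j) <= 0 by rewrite form_ecol; have := A_off ij; have := d_gt0 i; nia.
  have := form_pos y0; move: f1 f2 f3; rewrite !(formBl, formBr).
  by rewrite [form (ecol j) (ecol i)]form_sym [form (ecol i) y]form_sym; lia.
have ne : y - ecol i != y - ecol j.
  by apply: contraNneq ij => /addrI /oppr_inj /ecol_inj ->.
have := root_sub ri rj ne pos; rewrite opprB addrC addrA addrNK => r.
case: (root_sign r) => [/(_ i)|/(_ j)].
  by rewrite !mxE !eqxx !andbT (negPf ij).
by rewrite !mxE !eqxx !andbT eq_sym (negPf ij).
Qed.

Definition height x : int := \sum_j x j 0.

Lemma height_sub_ecol x i : height (x - ecol i) = height x - 1.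
Proof.
rewrite /height [in LHS](bigD1 i) // [in RHS](bigD1 i) //=.
rewrite -[ecol i]scale1r coord_sub_ecol_eq addrAC; congr (_ + _ - _).
by apply: eq_bigr => j ji; rewrite coord_sub_ecol.
Qed.

Lemma height_ge0 x : nonneg x -> 0 <= height x.
Proof. by move=> h; apply: sumr_ge0. Qed.

Lemma nonneg_trans y x z : nonneg (y - x) -> nonneg (z - y) -> nonneg (z - x).
Proof. by move=> h1 h2 i; rewrite -(subrKA y) mxE addr_ge0. Qed.

Lemma nonneg_sub_ecol x i : nonneg x -> 0 < x i 0 -> nonneg (x - ecol i).
Proof.
move=> hx xi j; rewrite -[ecol i]scale1r; have [->|ji] := eqVneq j i.
  by rewrite coord_sub_ecol_eq; lia.
by rewrite coord_sub_ecol.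
Qed.

(** [form z z] is a sum of terms [z k 0 * (d k * coroot k z)], and it is positive. *)
Lemma exists_coroot_gt0 z : nonneg z -> z != 0 -> exists2 k, 0 < z k 0 & 0 < coroot k z.
Proof.
move=> hz /form_pos pos.
suff /existsP [k /andP [zk ck]] : [exists k, (0 < z k 0) && (0 < coroot k z)] by exists k.
apply: contraTT pos => /existsPn h; rewrite -leNgt; apply: sumr_le0 => k _.
have := h k; rewrite negb_and -!leNgt => /orP [zk|ck].
  by have -> : z k 0 = 0 by [apply/eqP; rewrite eq_le zk hz]; rewrite mul0r.
by rewrite mulr_ge0_le0 // mulr_ge0_le0 // ltW.
Qed.

(* The bottom [x] of an [i]-string below [y] stays below [y] when [y] moves one step down its own
   [i]-string: otherwise close the gap [y - x] by simple roots from either end, [root_sub2]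
   preserving both hypotheses, until [y = x]. *)
Lemma string_step x y i : is_posroot A x -> x != ecol i -> ~ is_root A (x - ecol i) ->
  is_root A y -> is_root A (y - ecol i) -> nonneg (y - x) -> x i 0 < y i 0.
Proof.
have [m] := ubnP `|height (y - x)|%N; elim: m x y => // m IH x y hm hx xi bot ry ryi le.
have := le i; rewrite !mxE subr_ge0 le_eqVlt => /orP [/eqP Exy|//].
have z0 : y - x != 0 by apply/eqP => /eqP; rewrite subr_eq0 => /eqP E; apply: bot; rewrite -E.
have [k zk ck] := exists_coroot_gt0 le z0.
have ki : k != i by apply: contraTneq zk => ->; rewrite !mxE Exy subrr ltxx.
have ik : i != k by rewrite eq_sym.
have hge := height_ge0 (nonneg_sub_ecol le zk); rewrite height_sub_ecol in hge.
have zk' : x k 0 < y k 0 by move: zk; rewrite !mxE subr_gt0.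
(* Since [coroot k (y - x) > 0], either [y] can be lowered or [x] raised by [ecol k]. *)
have [cy|cy] := ltrP 0 (coroot k y).
  have yk : y != ecol k.
    apply: contraNneq z0 => E; rewrite E (@posroot_supp x k) ?subrr // => j jk.
    by have := le j; have := hx.2 j; rewrite E !mxE (negPf jk) /=; move: (x j 0) => c; lia.
  have ryk := root_sub_ecol ry cy yk.
  have [r|E] := root_sub2 (root_neq0 ry) ik ryi ryk.
    have : x i 0 < (y - ecol k) i 0.
      apply: IH hx xi bot ryk _ _; rewrite addrAC //; last exact: nonneg_sub_ecol.
      by move: hm hge; rewrite height_sub_ecol; move: (height _) => c; lia.
    by rewrite -[ecol k]scale1r coord_sub_ecol.
  case/eqP: xi; apply: posroot_supp => // j ji.
  have := le j; have := hx.2 j; rewrite E !mxE (negPf ji) /= add0r.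
  have [->|jk] := eqVneq j k; last by move: (x j 0) => c /=; lia.
  by move: zk'; rewrite E !mxE !eqxx (negPf ki) /=; move: (x k 0) => c; lia.
have cx : coroot k x < 0 by move: ck; rewrite corootB; lia.
have xk : x != - ecol k.
  by apply/eqP => E; have := hx.2 k; rewrite E !mxE !eqxx.
have rxk := root_add_ecol hx.1 cx xk.
have xkj j : j != k -> (x + ecol k) j 0 = x j 0.
  by move=> jk; rewrite -[ecol k]opprK -[- ecol k]scaleN1r coord_sub_ecol.
have xkk : (x + ecol k) k 0 = x k 0 + 1 by rewrite mxE ecolE eqxx.
have := IH (x + ecol k) y; rewrite xkj // opprD addrA; apply=> //.
- by move: hm hge; rewrite height_sub_ecol; move: (height _) => c; lia.
- by apply: (@posroot_coord _ k) => //; rewrite xkk; have := hx.2 k; move: (x k 0) => c; lia.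
- apply/eqP => /colP /(_ k); rewrite xkk ecolE (negPf ki).
  by have := hx.2 k; move: (x k 0) => c; lia.
- move=> r; have [|r'|E] := root_sub2 (root_neq0 rxk) ik r; first by rewrite addrK; case: hx.
  + by apply: bot; move: r'; rewrite addrAC addrK.
  by case/eqP: xi; move: E => /addIr.
- exact: nonneg_sub_ecol.
Qed.

Lemma sub_scaleS x i (s : nat) : x - s.+1%:Z *: ecol i = x - s%:Z *: ecol i - ecol i.
Proof. by rewrite intS [1 + _]addrC scalerDl scale1r opprD addrA. Qed.

(** Down to the middle of the string ([upper]) the coroot stays positive and [ecol i] can be
    subtracted; the lower half is the mirror image of the upper one. *)
Lemma string_roots b i (t : nat) : is_posroot A b -> b != ecol i -> t%:Z <= coroot i b ->
  is_root A (b - t%:Z *: ecol i).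
Proof.
move=> hb bi tb.
have upper (s : nat) : s%:Z * 2 <= coroot i b + 1 -> is_root A (b - s%:Z *: ecol i).
  elim: s => [_|s IH hs]; first by rewrite scale0r subr0; case: hb.
  have r : is_root A (b - s%:Z *: ecol i) by apply: IH; lia.
  rewrite sub_scaleS; apply: root_sub_ecol => //; first by rewrite corootB corootZ coroot_ecol A_diag; lia.
  apply/eqP => E; have [j ji] := posroot_other hb bi.
  by rewrite -(@coord_sub_ecol _ s%:Z i) // E ecolE (negPf ji).
have [|h] := lerP (t%:Z * 2) (coroot i b + 1); first exact: upper.
have := root_mul (inW_sref i) (@upper `|coroot i b - t%:Z|%N _).
rewrite sref_mul corootB corootZ coroot_ecol A_diag -addrA -opprD -scalerDl.
have -> : `|coroot i b - t%:Z|%N = coroot i b - t%:Z :> int by lia.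
have -> : coroot i b - t%:Z + (coroot i b - (coroot i b - t%:Z) * 2) = t%:Z by lia.
by apply; lia.
Qed.

Lemma string_bottom x i : is_posroot A x -> x != ecol i ->
  exists c : int, [/\ 0 <= c, is_posroot A (x - c *: ecol i) &
    ~ is_root A (x - c *: ecol i - ecol i)].
Proof.
have [m] := ubnP `|(x i 0)%R|%N; elim: m x => // m IH x hm hx xi.
have [r|r] := classic (is_root A (x - ecol i)); last by exists 0; rewrite scale0r subr0.
rewrite -[ecol i]scale1r in r; have hx' := posroot_shift hx xi r.
have [||c [c0 hc nc]] := IH _ _ hx'.
- have := hx'.2 i; rewrite coord_sub_ecol_eq; move: hm; move: (x i 0) => a; lia.
- apply/eqP => E; have [j ji] := posroot_other hx xi.
  by rewrite -(@coord_sub_ecol _ 1 i) // E ecolE (negPf ji).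
have E : x - 1 *: ecol i - c *: ecol i = x - (1 + c) *: ecol i.
  by rewrite scalerDl opprD addrA.
by exists (1 + c); rewrite -E; split=> //; lia.
Qed.

Lemma string_lower y b i : is_posroot A y -> y != ecol i -> is_posroot A b -> b != ecol i ->
  nonneg (b - y) ->
  exists c : int, [/\ 0 <= c, is_posroot A (y - c *: ecol i) &
    nonneg (sref A i *m b - (y - c *: ecol i))].
Proof.
move=> hy yi hb bi le; rewrite sref_mul.
(* Here the reflection raises [b], and [y] itself will do. Otherwise [s_i b] is reached by single
   steps down the string, each leaving room at coordinate [i] by [string_step]. *)
have [cb|cb] := lerP (coroot i b) 0.
  exists 0; rewrite scale0r subr0; split=> // j; rewrite addrAC.
  have := le j; have [->|ji] := eqVneq j i; last by rewrite coord_sub_ecol.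
  by rewrite coord_sub_ecol_eq subr_ge0 => /(le_trans cb).
have [c [c0 hx bot]] := string_bottom hy yi; exists c; split=> //; set x := y - _ in hx bot *.
have xi : x != ecol i.
  apply/eqP => E; have [j ji] := posroot_other hy yi.
  by rewrite -(@coord_sub_ecol _ c i) // -/x E ecolE (negPf ji).
have main (t : nat) : t%:Z <= coroot i b -> nonneg (b - t%:Z *: ecol i - x).
  elim: t => [_|t IH ht].
    rewrite scale0r subr0 => j; rewrite /x opprB addrCA addrC mxE [X in _ + X]mxE ecolE.
    by rewrite addr_ge0 ?le // mulr_ge0.
  have ht' : t%:Z <= coroot i b by lia.
  have r1 := string_roots hb bi ht'; have r2 := string_roots hb bi ht.
  rewrite sub_scaleS in r2 *; rewrite addrAC; apply: nonneg_sub_ecol; first exact: IH.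
  have := string_step hx xi bot r1 r2 (IH ht').
  by rewrite !mxE; move: (x i 0) => a; rewrite subr_gt0.
have := main `|coroot i b|%N; rewrite gtz0_abs //; apply; lia.
Qed.

(** * Rational elements *)

Lemma nu_posroot u (k : nat) x : u \in unitmx -> nu A u k x -> is_posroot A x /\ is_posroot A (invmx u *m x).
Proof.
by move=> uu; case: k => [[hx [y [hy E]]]|k [hx [y [[hy _] E]]]]; rewrite {2}E mulKmx.
Qed.

Lemma nu0I u x : u \in unitmx -> is_posroot A x -> is_posroot A (invmx u *m x) -> nu A u 0 x.
Proof. by move=> uu hx hy; split=> //; exists (invmx u *m x); rewrite mulKVmx. Qed.

(** With [nu0I] and [nuSE], this allows [nu A u k x] to be handled as a chain of [k] steps starting
    at [x]. *)
Lemma nuSI u (k : nat) x b : u \in unitmx -> is_posroot A x -> is_posroot A (invmx u *m x) ->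
  nu A u k b -> root_le (invmx u *m x) b -> nu A u k.+1 x.
Proof.
move=> uu hx hy hb le; split=> //; exists (invmx u *m x); rewrite mulKVmx //; split=> //.
by split=> //; exists b.
Qed.

Lemma nuSE u (k : nat) x : u \in unitmx -> nu A u k.+1 x -> exists2 b, nu A u k b & root_le (invmx u *m x) b.
Proof. by move=> uu [_ [y [[_ [b [hb le]]] ->]]]; exists b; rewrite ?mulKmx. Qed.

Lemma root_leE x y : root_le x y <-> nonneg (y - x).
Proof.
split=> h i; have := h i; rewrite !mxE; first by rewrite subr_ge0.
by rewrite subr_ge0.
Qed.

(** The number of columns is free because the identity is applied both to roots and to the matrix
    [w0]. *)
Lemma invmx_sref m u i (x : 'M[int]_(n, m)) : u \in unitmx -> sref A i *m u \in unitmx ->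
  invmx (sref A i *m u) *m x = invmx u *m (sref A i *m x).
Proof.
move=> uu us; rewrite -{1}[x]mul1mx -(srefK i) -[sref A i *m sref A i *m x]mulmxA.
by rewrite -{1}[sref A i *m x](mulKVmx uu) [sref A i *m (u *m _)]mulmxA mulKmx.
Qed.

Lemma rational_source u j : inW A u -> rational A u -> nonneg (invmx u *m ecol j) ->
  exists2 i, nonneg (invmx u *m ecol i) & nonneg (- (u *m ecol i)).
Proof.
move=> hu [k empty] hj; have uu := inW_unit hu; have hv := inW_inv hu.
apply: NNPP => none; suff [x hx] : exists x, nu A u k x by exact: empty hx.
elim: k {empty} => [|k [b hb]].
  exists (ecol j); apply: nu0I => //; first exact: posroot_ecol.
  by split=> //; apply: root_mul (root_ecol j).
have [[rb pb] [rvb pvb]] := nu_posroot uu hb.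
(* As [invmx u *m b] is positive, [invmx u] cannot make every simple root in the support of [b]
   negative. *)
have [i [bi hi]] : exists i, 0 < b i 0 /\ nonneg (invmx u *m ecol i).
  apply: NNPP => h; apply: (root_nonneg_anti rvb pvb); rewrite -mulNmx.
  apply: nonneg_mul => // i bi; rewrite mulNmx.
  by case: (root_sign (root_mul hv (root_ecol i))) => // hi; case: h; exists i.
(* The chain is prolonged by [u e_i], whose image under [u^-1] is [e_i], below [b]. *)
exists (u *m ecol i); have ru := root_mul hu (root_ecol i).
have hui : is_posroot A (u *m ecol i).
  by split=> //; case: (root_sign ru) => // neg; case: none; exists i.
apply: (nuSI (b := b)) => //; rewrite mulKmx //; first exact: posroot_ecol.
by move=> l; rewrite ecolE; case: eqP => [->|_]; [lia | exact: pb].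
Qed.

(* A chain for [s_i u] starting at [x] is turned into a chain for [u] starting above [s_i x], by
   replacing each [u^-1 (s_i x)] with the bottom of its [i]-string; as [u e_i < 0], this only
   increases the chain. *)
Lemma rational_sref u i : inW A u -> nonneg (invmx u *m ecol i) -> nonneg (- (u *m ecol i)) ->
  rational A u -> rational A (sref A i *m u).
Proof.
move=> hu hvi hui [k empty]; exists k => x hx.
suff [y hy _] : exists2 y, nu A u k y & nonneg (y - sref A i *m x) by exact: empty hy.
have uu := inW_unit hu; have hv := inW_inv hu.
have us : sref A i *m u \in unitmx := inW_unit (inW_mul (inW_sref i) hu).
have nui : ~ nonneg (u *m ecol i).
  by move=> h; apply: root_nonneg_anti h hui; apply: root_mul (root_ecol i).
(* [z = ecol i] is impossible: [u^-1 s_i] makes [ecol i] negative. *)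
have facts l z : nu A (sref A i *m u) l z -> [/\ is_posroot A z, z != ecol i,
    is_posroot A (sref A i *m z) & is_posroot A (invmx u *m (sref A i *m z))].
  move=> /(nu_posroot us) []; rewrite invmx_sref // => hz hvz.
  have zi : z != ecol i.
    apply/eqP => E; move: hvz; rewrite E sref_ecol mulmxN => -[_ neg].
    by apply: root_nonneg_anti hvi neg; apply: root_mul (root_ecol i).
  by split=> //; exact: posroot_sref.
elim: k {empty} x hx => [|k IH] x hx.
  have [_ _ h1 h2] := facts _ _ hx.
  by exists (sref A i *m x); [exact: nu0I | rewrite subrr => j; rewrite mxE].
have [hx0 xi hsx hvx] := facts _ _ hx.
have [b hb] := nuSE us hx; rewrite invmx_sref // => /root_leE le.
have [hb0 bi _ _] := facts _ _ hb; have [s hs les] := IH _ hb.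
have yi : invmx u *m (sref A i *m x) != ecol i.
  by apply/eqP => E; case: nui; rewrite -E mulKVmx //; case: hsx.
have [c [c0 hy ley]] := string_lower hvx yi hb0 bi le; set y := _ - c *: _ in hy ley.
have Euy : u *m y = sref A i *m x - c *: (u *m ecol i).
  by rewrite mulmxBr mulKVmx // -scalemxAr.
have leuy : nonneg (u *m y - sref A i *m x).
  move=> j; rewrite Euy addrAC subrr add0r -scalerN mxE.
  by rewrite mulr_ge0.
exists (u *m y) => //; apply: nuSI hs _ => //; rewrite ?mulKmx //.
  split; first exact: root_mul hy.1.
  by move=> j; rewrite -[u *m y](subrK (sref A i *m x)) mxE addr_ge0 //; case: hsx => _ ->.
by apply/root_leE; exact: nonneg_trans ley les.
Qed.

(** * The longest element and the paths leading to it *)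

Section LongestElement.

Variables (w0 : 'M[int]_n) (eps : 'I_n -> 'I_n).
Hypothesis w0W : inW A w0.
Hypothesis w0E : forall i, w0 *m ecol i = - ecol (eps i).

Lemma w0_nonneg x : nonneg x -> nonneg (- (w0 *m x)).
Proof.
move=> hx; rewrite -mulNmx; apply: nonneg_mul => // j _.
by rewrite mulNmx w0E opprK; exact: nonneg_ecol.
Qed.

Lemma w0K : w0 *m w0 = 1%:M.
Proof.
apply: inW_nonneg_id => [|i]; first exact: inW_mul.
by rewrite -mulmxA w0E mulmxN; apply: w0_nonneg; exact: nonneg_ecol.
Qed.

Lemma invmx_w0 : invmx w0 = w0.
Proof. by rewrite -[LHS]mulmx1 -w0K mulKmx // inW_unit. Qed.

Lemma epsK : involutive eps.
Proof.
move=> i; apply: ecol_inj; rewrite -[RHS]mul1mx -w0K -mulmxA !w0E mulmxN w0E.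
by rewrite opprK.
Qed.

Lemma eps_cartan i j : A (eps i) (eps j) = A i j.
Proof.
have E k l : d (eps k) * A (eps k) (eps l) = d k * A k l.
  by have := form_inW (ecol k) (ecol l) w0W; rewrite !w0E formNl formNr opprK !form_ecol.
have dd : d (eps i) = d i by have := E i i; rewrite !A_diag; lia.
by have := E i j; rewrite dd => /(mulfI (lt0r_neq0 (d_gt0 i))).
Qed.

Lemma w0_sref i : w0 *m sref A i = sref A (eps i) *m w0.
Proof. by apply: (@inW_conj_sref _ _ _ (-1)); rewrite ?scaleN1r // mulrNN mulr1. Qed.

Lemma wprod_eps w : wprod A (map eps w) = w0 *m wprod A w *m w0.
Proof.
elim: w => [|i w IH] /=; first by rewrite mulmx1 w0K.
by rewrite IH !mulmxA w0_sref.
Qed.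

Lemma w0_posroot x : is_posroot A x -> is_posroot A (- (w0 *m x)).
Proof. by move=> [r p]; split; [apply/root_opp/root_mul | apply: w0_nonneg]. Qed.

(** [x] to [- w0 x] preserves positive roots and their order, and carries chains for [u] to chains
    for [w0 u w0]. One direction suffices, [w0] being an involution. *)
Lemma rational_w0_conj u : inW A u -> rational A (w0 *m u *m w0) -> rational A u.
Proof.
move=> hu [k empty]; exists k => x hx.
suff : nu A (w0 *m u *m w0) k (- (w0 *m x)) by exact: empty.
have uu := inW_unit hu.
have wu : w0 *m u *m w0 \in unitmx by apply: inW_unit; do 2?apply: inW_mul.
have E z : invmx (w0 *m u *m w0) *m - (w0 *m z) = - (w0 *m (invmx u *m z)).
  rewrite -(mulKmx wu (- (w0 *m (invmx u *m z)))); congr (_ *m _).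
  by rewrite !mulmxN -!mulmxA (mulmxA w0 w0) w0K mul1mx mulKVmx.
elim: k {empty} x hx => [|k IH] x hx; have [h1 h2] := nu_posroot uu hx.
  by apply: nu0I => //; rewrite ?E; exact: w0_posroot.
have [b hb /root_leE le] := nuSE uu hx.
apply: (nuSI (b := - (w0 *m b))) => //; rewrite ?E; try exact: w0_posroot; first exact: IH.
by apply/root_leE; rewrite -opprD -mulmxBr; exact: w0_nonneg.
Qed.

Lemma rational_eps w : rational A (wprod A w) <-> rational A (wprod A (map eps w)).
Proof.
have hw : inW A (wprod A w) by exists w.
rewrite wprod_eps; split=> h; apply: rational_w0_conj => //.
  by do 2?apply: inW_mul.
by rewrite !mulmxA w0K mul1mx -mulmxA w0K mulmx1.
Qed.

Lemma nu0_w0 x : ~ nu A w0 0 x.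
Proof.
move=> hx; have [[r p] [_]] := nu_posroot (inW_unit w0W) hx; rewrite invmx_w0 => h.
by apply: (root_nonneg_anti (root_mul w0W r) h); exact: w0_nonneg.
Qed.

Lemma vertex_w0 : is_vertex A w0.
Proof. by split=> //; exists 0%N; exact: nu0_w0. Qed.

(** Induction on the length of a word for [invmx u *m w0]. If this element keeps all simple roots
    positive, then [u = w0]. The sign of [u e_i] is passed on for use when [w0 = -1]. *)
Lemma rational_ind (Q : 'M[int]_n -> Prop) : Q w0 ->
  (forall u i, is_vertex A u -> nonneg (- (u *m ecol i)) -> is_vertex A (sref A i *m u) ->
     Q (sref A i *m u) -> Q u) ->
  forall u, is_vertex A u -> Q u.
Proof.
move=> Q0 QS u hu; have [t Et] : inW A (invmx u *m w0) by apply/inW_mul/w0W/inW_inv/hu.1.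
have [m] := ubnP (size t); elim: m u t hu Et => // m IH u t [hu rat] Et st.
have uu := inW_unit hu.
have [pos|] := classic (forall j, nonneg (wprod A t *m ecol j)).
  have := inW_nonneg_id _ pos; rewrite -Et => /(_ (inW_mul (inW_inv hu) w0W)) E.
  by rewrite -[u]mulmx1 -E mulKVmx.
move=> /not_all_ex_not [j neg].
(* A simple root kept positive by [u^-1] starts the chains in [rational_source]. *)
have hj : nonneg (invmx u *m ecol (eps j)).
  have [] := root_sign (root_mul (inW_inv hu) (root_ecol (eps j))) => // h.
  by case: neg; rewrite -Et -mulmxA w0E mulmxN.
have [i hvi hui] := rational_source hu rat hj.
have [|t' st' Et'] := @inW_exchange t (eps i).
  by rewrite -Et -mulmxA w0E epsK mulmxN opprK.
have us : is_vertex A (sref A i *m u).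
  by split; [exact/inW_mul/hu/inW_sref | exact: rational_sref].
apply: (QS u i) => //; apply: (IH _ t') => //; last by lia.
rewrite invmx_sref //; last exact: inW_unit us.1.
by rewrite Et' -Et -mulmxA w0_sref epsK.
Qed.

Definition joined u v := exists p, gpath A u p /\ last u p = v.

Lemma joined_refl u : joined u u.
Proof. by exists [::]. Qed.

Lemma joined_trans v u g : joined u v -> joined v g -> joined u g.
Proof.
move=> [p [gp <-]] [q [gq <-]]; exists (p ++ q); rewrite last_cat; split=> //.
by elim: p u gp gq => //= x p IH u [hx hu gp] gq; split=> //; exact: IH.
Qed.

Lemma joined_sref u i : is_vertex A (sref A i *m u) -> joined u (sref A i *m u).
Proof. by move=> h; exists [:: sref A i *m u]; split=> //; split=> //; exists i. Qed.

Lemma joined_sym u v : is_vertex A u -> joined u v -> joined v u.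
Proof.
move=> hu [p [gp <-]]; elim: p u hu gp => [|x p IH] u hu /=; first by move=> _; exact: joined_refl.
move=> [hx [i E] gp]; apply: joined_trans (IH x hx gp) _.
have Eu : u = sref A i *m x by rewrite E mulmxA srefK mul1mx.
by rewrite Eu; apply: joined_sref; rewrite -Eu.
Qed.

Lemma rational_connected : rgraph_connected A.
Proof.
have to_w0 : forall u, is_vertex A u -> joined u w0.
  apply: rational_ind => [|u i hu _ hsu]; first exact: joined_refl.
  by apply: joined_trans; exact: joined_sref.
by move=> u v hu hv; apply: joined_trans (to_w0 u hu) (joined_sym hv (to_w0 v hv)).
Qed.

Lemma vertex_opp1 : w0 = - 1%:M -> forall u, is_vertex A u -> u = w0.
Proof.
move=> E; apply: (@rational_ind (eq^~ w0)) => // u i hu neg _ Eu; exfalso.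
apply: (@root_nonneg_anti (ecol i)); [exact: root_ecol | exact: nonneg_ecol |].
have <- : u *m ecol i = ecol i; last by [].
rewrite -[u]mul1mx -(srefK i) -(mulmxA _ _ u) Eu E mulmxN mulmx1 mulNmx sref_ecol.
by rewrite opprK.
Qed.

Lemma w0_neq_opp1 : w0 <> - 1%:M -> exists i, eps i != i.
Proof.
move=> h; apply/existsP; apply: contra_notT h => /existsPn h; apply: eq_on_ecol => i.
by rewrite w0E mulNmx mul1mx; have := h i; rewrite negbK => /eqP ->.
Qed.

(** For [u = s_i w0], [nu^0] contains at most [e_i]. A member [x] of [nu^1] then has [u^-1 x = e_i],
    so [x = - s_i e_(eps i)], which is negative as [eps i != i]. *)
Lemma vertex_sref_w0 i : eps i != i -> is_vertex A (sref A i *m w0).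
Proof.
move=> ei; have hu : inW A (sref A i *m w0) by apply/inW_mul/w0W/inW_sref.
have uu := inW_unit hu; split=> //; exists 1%N => x hx.
have E z : invmx (sref A i *m w0) *m z = w0 *m (sref A i *m z).
  by rewrite invmx_sref ?invmx_w0 //; exact: inW_unit.
have only z : nu A (sref A i *m w0) 0 z -> z = ecol i.
  move=> /(nu_posroot uu) [hz]; rewrite E => -[rz pz].
  apply/eqP; apply: contraTT isT => zi; exfalso.
  have hsz := posroot_sref hz zi.
  by apply: root_nonneg_anti rz pz _; exact: w0_nonneg hsz.2.
have [b hb le] := nuSE uu hx; have [_ [rz pz]] := nu_posroot uu hx.
have bi := only _ hb.
have Ez : invmx (sref A i *m w0) *m x = ecol i.
  apply: posroot_supp => // j ji; apply/eqP; rewrite eq_le pz andbT.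
  by have := le j; rewrite bi ecolE (negPf ji).
have [[rx px] _] := nu_posroot uu hx.
have Ex : x = - (sref A i *m ecol (eps i)).
  by rewrite -[x](mulKVmx uu) Ez -mulmxA w0E mulmxN.
have := posroot_sref (posroot_ecol (eps i)) (i := i); rewrite (inj_eq ecol_inj) => /(_ ei) [r p].
by apply: root_nonneg_anti r p _; rewrite -Ex.
Qed.

Lemma vertices_iff : (exists u v, [/\ is_vertex A u, is_vertex A v & u != v]) <-> w0 != - 1%:M.
Proof.
split=> [[u [v [hu hv]]]|/eqP /w0_neq_opp1 [i ei]].
  by apply: contraNneq => E; rewrite (vertex_opp1 E hu) (vertex_opp1 E hv).
exists (sref A i *m w0), w0; split; [exact: vertex_sref_w0 | exact: vertex_w0 |].
apply/eqP => E; have Es : sref A i = 1%:M by rewrite -[LHS]mulmx1 -w0K mulmxA E.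
by have := sref_ecol i; rewrite Es mul1mx => /colP /(_ i); rewrite [RHS]mxE ecolE eqxx.
Qed.

(* [A c = 0 mod N] says that [c / N] is a weight, and [W] acts trivially on weights modulo
   roots. *)
Lemma inW_congr (N : int) x : (forall i, N %| coroot i x)%Z ->
  forall M, inW A M -> forall i, (N %| ((M *m x - x) i 0)%R)%Z.
Proof.
move=> hx M [w ->]; elim: w => [|k w IH] i /=; first by rewrite mul1mx subrr mxE dvdz0.
set y := wprod A w *m x.
have -> : (sref A k *m wprod A w) *m x - x = (y - x) - coroot k y *: ecol k.
  by rewrite -mulmxA sref_mul addrAC.
rewrite mxE [X in _ + X]mxE rpredB ?IH // mxE dvdz_mulr // -(subrK x y) corootD rpredD ?hx //.
by rewrite corootE rpred_sum // => j _; rewrite dvdz_mull.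
Qed.

End LongestElement.

(** * Dynkin diagrams with a nontrivial involution *)

Section Diagram.

Hypothesis A_conn : forall S : {set 'I_n}, S != set0 -> S != setT ->
  exists i j, [/\ i \in S, j \notin S & A i j != 0].

Implicit Types f : 'I_n -> int.

Definition row_sum f i : int := \sum_j A i j * f j.

(** [form x x] is the sum of [f i * (d i * row_sum f i)], hence at most 0, against definiteness. *)
Lemma no_subharmonic f : (forall i, 0 <= f i) -> (exists i, 0 < f i) ->
  (forall i, 0 < f i -> row_sum f i <= 0) -> False.
Proof.
move=> f0 [i fi] sub; have x0 : \col_j f j != 0.
  by apply/eqP => /colP /(_ i); rewrite !mxE => E; rewrite E ltxx in fi.
have := form_pos x0; rewrite ltNge => /negP; apply; apply: sumr_le0 => j _.
rewrite mxE corootE; have := f0 j; rewrite le_eqVlt => /orP [/eqP <-|fj]; first by rewrite mul0r.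
rewrite !mulr_ge0_le0 // ?(ltW (d_gt0 j)) // (le_trans _ (sub j fj)) // le_eqVlt; apply/orP; left.
by apply/eqP/eq_bigr => k _; rewrite mxE.
Qed.

(** Off-diagonal entries are nonpositive, so dropping nodes outside [T] can only raise the sum, once
    the diagonal term is kept or vanishes. *)
Lemma row_sum_le f i (T : {set 'I_n}) : (forall j, 0 <= f j) -> i \in T \/ f i = 0 ->
  row_sum f i <= \sum_(j in T) A i j * f j.
Proof.
move=> f0 iT; rewrite /row_sum (bigID (mem T)) /= -[leRHS]addr0 lerD2l; apply: sumr_le0 => j jT.
have [Ej|ij] := eqVneq i j; last by rewrite mulr_le0_ge0 ?A_off.
by case: iT => [|fi]; [rewrite Ej (negPf jT) | rewrite -Ej fi mulr0].
Qed.

Lemma row_sum_le0 f i : (forall j, 0 <= f j) -> f i = 0 -> row_sum f i <= 0.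
Proof. by move=> f0 fi; have := @row_sum_le f i set0 f0 (or_intror fi); rewrite big_set0. Qed.

Lemma row_sum_le1 f i a : (forall j, 0 <= f j) -> i = a \/ f i = 0 -> row_sum f i <= A i a * f a.
Proof.
move=> f0 ia; have iT : i \in [set a] \/ f i = 0.
  by case: ia => [->|]; [left; exact: set11 | right].
by have := row_sum_le f0 iT; rewrite big_set1.
Qed.

Lemma row_sum_le2 f i a b : (forall j, 0 <= f j) -> a != b -> i = a \/ f i = 0 ->
  row_sum f i <= A i a * f a + A i b * f b.
Proof.
move=> f0 ab ia; have iT : i \in [set a; b] \/ f i = 0.
  by case: ia => [->|]; [left; exact: set21 | right].
by have := row_sum_le f0 iT; rewrite big_setU1 ?inE // big_set1.
Qed.

Lemma row_sum_le3 f i a b c : (forall j, 0 <= f j) -> a != b -> a != c -> b != c ->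
  i = a \/ f i = 0 -> row_sum f i <= A i a * f a + (A i b * f b + A i c * f c).
Proof.
move=> f0 ab ac bc ia; have iT : i \in a |: [set b; c] \/ f i = 0.
  by case: ia => [->|]; [left; exact: setU11 | right].
have := row_sum_le f0 iT.
by rewrite big_setU1 ?inE ?negb_or ?ab ?ac // big_setU1 ?inE // big_set1.
Qed.

Lemma A_le_opp1 i j : i != j -> A i j != 0 -> A i j <= -1.
Proof. by move=> /A_off h; move: h; rewrite le_eqVlt => /orP [/eqP ->|] //; lia. Qed.

Lemma A_neq0_sym i j : (A i j != 0) = (A j i != 0).
Proof. by congr (~~ _); apply/eqP/eqP => /A_zero. Qed.

(* [w] lists weights on the nodes [L]; an entry [(b, m)] of the [a]-th list of [N] stands for an
   edge of multiplicity at least [m] from the [a]-th to the [b]-th node. *)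
Lemma no_affine_subdiagram (L : seq 'I_n) (w : seq nat) (N : seq (seq (nat * nat))) i0 :
  uniq L -> size w = size L -> (0 < size L)%N ->
  all (fun a => [&& (0 < nth 0%N w a)%N, uniq (map fst (nth [::] N a)), a \notin map fst (nth [::] N a),
    all (fun b => (b < size w)%N) (map fst (nth [::] N a)) &
    (2 * nth 0%N w a <= sumn [seq p.2 * nth 0%N w p.1 | p <- nth [::] N a])%N]) (iota 0 (size w)) ->
  all (fun a => all (fun p => A (nth i0 L a) (nth i0 L p.1) <= - (p.2)%:Z) (nth [::] N a))
    (iota 0 (size L)) -> False.
Proof.
move=> uL sw L0 /allP num /allP edge.
(* Off [L] the index is [size L = size w], so the default 0 extends [w] by zero. *)
pose f (v : 'I_n) : int := (nth 0%N w (index v L))%:Z.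
have f0 v : 0 <= f v by [].
have fL (a : nat) : (a < size L)%N -> f (nth i0 L a) = (nth 0%N w a)%:Z.
  by move=> aL; rewrite /f index_uniq.
apply: (@no_subharmonic f) => // [|v fv].
  exists (nth i0 L 0); rewrite fL // ltz_nat; have := num 0%N.
  by rewrite mem_iota sw L0 => /(_ erefl) /andP [].
have vL : v \in L.
  by rewrite -index_mem -sw ltnNge; apply/negP => h; move: fv; rewrite /f nth_default.
move: (index_mem v L); rewrite vL => /idP; set a := index v L => aL.
have va : v = nth i0 L a by rewrite nth_index.
have := num a; rewrite mem_iota sw aL => /(_ erefl) /and5P [wa uN aN /allP ltN le].
have := edge a; rewrite mem_iota aL => /(_ erefl); rewrite -va => /allP edgea.
set Na := nth [::] N a in uN aN ltN le edgea.
have E : row_sum f v <= A v v * f v + \sum_(p <- Na) A v (nth i0 L p.1) * f (nth i0 L p.1).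
  pose s := v :: [seq nth i0 L p.1 | p <- Na].
  have us : uniq s.
    rewrite /= map_inj_in_uniq; last first.
      move=> p q hp hq; move/eqP; rewrite nth_uniq //; last 2 first.
      - by rewrite ltN // map_f.
      - by rewrite ltN // map_f.
      move=> /eqP Epq; move: uN hp hq; rewrite /= => uN hp hq.
      have : index p Na = index q Na.
        have hp' := hp; rewrite -index_mem in hp'; have hq' := hq; rewrite -index_mem in hq'.
        apply/eqP; rewrite -(nth_uniq 0%N _ _ uN) ?size_map //.
        by rewrite !(nth_map p) // !nth_index // Epq.
      by move=> Ei; rewrite -(nth_index p hp) Ei nth_index.
    rewrite (map_uniq uN) andbT; apply/mapP => -[p hp /eqP].
    rewrite va nth_uniq //; last by rewrite ltN // map_f.
    by move=> /eqP Ea; case/negP: aN; rewrite Ea map_f.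
  have := @row_sum_le f v [set j in s] f0; rewrite inE mem_head => /(_ (or_introl isT)).
  rewrite (eq_bigl (mem s)); last by move=> j; rewrite inE.
  by rewrite -big_uniq //= big_cons big_map.
have S : \sum_(p <- Na) A v (nth i0 L p.1) * f (nth i0 L p.1)
    <= - (sumn [seq p.2 * nth 0%N w p.1 | p <- Na]%N)%:Z.
  elim: Na edgea ltN {E uN aN le} => [|p s IH] edgea ltN; first by rewrite big_nil.
  rewrite big_cons /= PoszD opprD; apply: lerD; last first.
    by apply: IH => q qs; [apply: edgea | apply: ltN]; rewrite /= in_cons qs orbT.
  rewrite fL; last by rewrite ltN //= mem_head.
  by have := edgea p (mem_head _ _); rewrite PoszM -mulNr => h; apply: ler_wpM2r.
have fv' : f v = (nth 0%N w a)%:Z by rewrite [in LHS]va fL.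
by move: E S; rewrite A_diag fv'; lia.
Qed.


Definition indic (S : {set 'I_n}) j : int := (j \in S)%:R.

Lemma indic_ge0 S j : 0 <= indic S j.
Proof. exact: ler0n. Qed.

Lemma indic_in (S : {set 'I_n}) j : j \in S -> indic S j = 1.
Proof. by rewrite /indic => ->. Qed.

Lemma indic_notin (S : {set 'I_n}) j : j \notin S -> indic S j = 0.
Proof. by rewrite /indic => /negPf ->. Qed.

Lemma row_sum_comb f f' c c' i :
  row_sum (fun j => c * f j + c' * f' j) i = c * row_sum f i + c' * row_sum f' i.
Proof.
by rewrite /row_sum !mulr_sumr -big_split; apply: eq_bigr => j _; rewrite mulrDr !(mulrCA (A i j)).
Qed.

(** * Growing a subharmonic weight along the diagram *)

Section Chain.

Variable tau : 'I_n -> 'I_n.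
Hypothesis tauK : involutive tau.
Hypothesis tau_cartan : forall i j, A (tau i) (tau j) = A i j.

Lemma row_sum_tau f i : (forall j, f (tau j) = f j) -> row_sum f (tau i) = row_sum f i.
Proof.
move=> ft; rewrite /row_sum (reindex_inj (inv_inj tauK)).
by apply: eq_bigr => j _; rewrite tau_cartan ft.
Qed.

Definition tau_stable (S : {set 'I_n}) := forall j, (tau j \in S) = (j \in S).

Lemma indic_tau S j : tau_stable S -> indic S (tau j) = indic S j.
Proof. by rewrite /indic => ->. Qed.

(** A singleton when [tau] fixes [c]: [tau] is the identity for a fork growing along its trunk, and
    [eps] for a path growing at both ends. *)
Definition tau_pair c : {set 'I_n} := [set c; tau c].

Lemma tau_pair_stable c : tau_stable (tau_pair c).
Proof. by move=> j; rewrite !inE (inv_eq tauK) (inj_eq (inv_inj tauK)) orbC. Qed.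

(* [x] is subharmonic, with just enough room at [r] (and at [tau r]) for attaching there a new
   node of weight [x r]. *)
Definition open_weight (x : 'I_n -> int) r :=
  [/\ forall i, 0 <= x i, forall i, x (tau i) = x i, 0 < x r,
      forall i, 0 < x i -> i != r -> i != tau r -> row_sum x i <= 0 & row_sum x r <= x r].

Section Step.

Variables (x : 'I_n -> int) (r : 'I_n).
Hypothesis open_x : open_weight x r.

(** The excluded vector is [k x + y 1_S]. Off [S] the indicator only lowers row sums, so [r] and [S]
    alone need checking; [tau r] follows by symmetry. *)
Lemma open_contra (S : {set 'I_n}) (k y : int) : tau_stable S -> 0 < k -> 0 <= y ->
  (forall s, s \in S -> x s = 0) -> k * x r + y * row_sum (indic S) r <= 0 ->
  (forall s, s \in S -> k * row_sum x s + y * row_sum (indic S) s <= 0) -> False.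
Proof.
case: open_x => x0 xt xr rows rowr St k0 y0 xS hr hS.
pose f j := k * x j + y * indic S j.
have f0 j : 0 <= f j by rewrite addr_ge0 ?mulr_ge0 ?indic_ge0 // ltW.
have ft j : f (tau j) = f j by rewrite /f xt indic_tau.
have fr : row_sum f r <= 0.
  by rewrite row_sum_comb (le_trans _ hr) // lerD2r ler_pM2l.
apply: (no_subharmonic f0) => [|i fi].
  by exists r; rewrite /f ltr_pwDl ?mulr_ge0 ?indic_ge0 // mulr_gt0.
have [iS|iS] := boolP (i \in S); first by rewrite row_sum_comb hS.
have [->//|ir] := eqVneq i r.
have [->|itr] := eqVneq i (tau r); first by rewrite row_sum_tau.
have xi : 0 < x i by move: fi; rewrite /f indic_notin // mulr0 addr0 pmulr_rgt0.
have := row_sum_le0 (indic_ge0 S) (indic_notin iS); have := rows i xi ir itr.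
by rewrite row_sum_comb => h1 h2; rewrite -[leRHS]addr0 lerD // mulr_ge0_le0 // ltW.
Qed.

Section Neighbour.

Variable c : 'I_n.
Hypothesis xc : x c = 0.
Hypothesis rc : A r c != 0.

Let x_ge0 : forall i, 0 <= x i. Proof. by case: open_x. Qed.
Let x_tau : forall i, x (tau i) = x i. Proof. by case: open_x. Qed.
Let xr_gt0 : 0 < x r. Proof. by case: open_x. Qed.
Let row_r : row_sum x r <= x r. Proof. by case: open_x. Qed.

Lemma neighbour_neq : r != c.
Proof. by apply: contraTneq xr_gt0 => ->; rewrite xc. Qed.

Lemma neighbour_le : A r c <= -1.
Proof. exact/A_le_opp1/rc/neighbour_neq. Qed.

Lemma neighbour_le' : A c r <= -1.
Proof.
apply: A_le_opp1; first by rewrite eq_sym neighbour_neq.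
by rewrite A_neq0_sym.
Qed.

Let scale_row (a m : int) : a <= m -> x r * a <= x r * m.
Proof. by apply: ler_wpM2l; exact: ltW. Qed.

Lemma neighbour_row : row_sum x c <= x r * A c r.
Proof. by rewrite mulrC; apply: row_sum_le1 => //; right. Qed.

Lemma notin_weight (S : {set 'I_n}) : (forall s, s \in S -> x s = 0) -> r \notin S.
Proof. by move=> h; apply/negP => /h E; move: xr_gt0; rewrite E. Qed.

Lemma weight_pair s : s \in tau_pair c -> x s = 0.
Proof. by rewrite !inE => /orP [/eqP ->|/eqP ->]; rewrite ?x_tau. Qed.

Lemma indic_pair_row : row_sum (indic (tau_pair c)) r <= A r c.
Proof.
have := @row_sum_le1 (indic (tau_pair c)) r c (indic_ge0 _) _.
rewrite [indic _ c]indic_in ?set21 // mulr1; apply; right.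
exact/indic_notin/notin_weight/weight_pair.
Qed.

Lemma indic_row_in (S : {set 'I_n}) s : s \in S -> row_sum (indic S) s <= 2.
Proof.
move=> sS; have := @row_sum_le1 (indic S) s s (indic_ge0 _) (or_introl erefl).
by rewrite indic_in // A_diag mulr1.
Qed.

Lemma open_contra_pair (k y : int) : 0 < k -> 0 <= y ->
  k * x r + y * row_sum (indic (tau_pair c)) r <= 0 ->
  k * row_sum x c + y * row_sum (indic (tau_pair c)) c <= 0 -> False.
Proof.
move=> k0 y0 hr hc; apply: (open_contra (tau_pair_stable c) k0 y0 weight_pair hr) => s.
rewrite !inE => /orP [/eqP ->|/eqP ->] //.
by rewrite !row_sum_tau // => j; apply: indic_tau; exact: tau_pair_stable.
Qed.

(** Two new neighbours, each with half the weight of [r], absorb the excess at [r]: the vector is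
    [2 x + x_r 1_S]. *)
Lemma neighbour_unique c' : x c' = 0 -> A r c' != 0 -> c' = c.
Proof.
move=> xc' rc'; apply: NNPP => /eqP cc'; pose S := tau_pair c :|: tau_pair c'.
have St : tau_stable S by move=> j; rewrite in_setU [RHS]in_setU !tau_pair_stable.
have Sx s : s \in S -> x s = 0.
  rewrite !inE -orbA => /or4P [] /eqP ->; by rewrite ?x_tau.
have rc'1 : A r c' <= -1.
  by apply: A_le_opp1 => //; apply: contraTneq xr_gt0 => ->; rewrite xc'.
have c'r1 : A c' r <= -1.
  apply: A_le_opp1; last by rewrite -A_neq0_sym.
  by apply: contraTneq xr_gt0 => <-; rewrite xc'.
have cS : c \in S by rewrite !inE eqxx.
have c'S : c' \in S by rewrite !inE eqxx !orbT.
have xr0 := xr_gt0.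
apply: (open_contra (k := 2) (y := x r) St) => //.
  have := @row_sum_le2 (indic S) r c c' (indic_ge0 S).
  rewrite eq_sym => /(_ cc' (or_intror (indic_notin (notin_weight Sx)))).
  rewrite (indic_in cS) (indic_in c'S).
  have := neighbour_le; move: (row_sum _ _) => a h1 h2.
  have /scale_row : a <= -2 by lia.
  by lia.
have key v : v \in S -> row_sum x v <= - x r -> 2 * row_sum x v + x r * row_sum (indic S) v <= 0.
  by move=> vS; have := scale_row (indic_row_in vS); move: (row_sum _ _) (row_sum _ _) => a b; lia.
have rowc : row_sum x c <= - x r.
  by apply: le_trans neighbour_row _; have := scale_row neighbour_le'; lia.
have rowc' : row_sum x c' <= - x r.
  apply: le_trans (@row_sum_le1 x c' r x_ge0 (or_intror xc')) _.
  by rewrite mulrC; have := scale_row c'r1; lia.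
by move=> s sS; apply: key => //; move: sS; rewrite !inE -orbA => /or4P [] /eqP -> //;
  rewrite row_sum_tau.
Qed.

(** The excluded vector is [2 x + x_r 1_S] if [A r c <= -2] and [x + x_r 1_S] if [A c r <= -2],
    where [S] is the pair of [c]. *)
Lemma neighbour_simple : A r c = -1 /\ A c r = -1.
Proof.
have h1 := neighbour_le; have h2 := neighbour_le'; have h3 := neighbour_row.
have h4 := indic_pair_row; have h5 := scale_row (@indic_row_in (tau_pair c) c (set21 _ _)).
have xr0 := ltW xr_gt0; split; apply: NNPP => ne.
  have r2 : A r c <= -2 by lia.
  apply: (@open_contra_pair 2 (x r)) => //.
    by have := scale_row (le_trans h4 r2); move: (row_sum _ _) => a; lia.
  by have := scale_row h2; move: h3 h5; move: (row_sum _ _) (row_sum _ _) => a b; lia.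
have c2 : A c r <= -2 by lia.
apply: (@open_contra_pair 1 (x r)) => //.
  by have := scale_row (le_trans h4 h1); move: (row_sum _ _) => a; lia.
by have := scale_row c2; move: h3 h5; move: (row_sum _ _) (row_sum _ _) => a b; lia.
Qed.

Lemma indic_pair_end : x r * row_sum (indic (tau_pair c)) r <= - x r.
Proof. by have [h _] := neighbour_simple; have := scale_row indic_pair_row; rewrite h mulrN1. Qed.

(** Such an edge closes a cycle: with weight [x r], the node [c] is balanced by [r] and [tau r]. *)
Lemma neighbour_tau_end : tau r != r -> A c (tau r) = 0.
Proof.
move=> tr; apply: NNPP => /eqP ctr; have [h1 h2] := neighbour_simple.
have xtr := x_tau r.
have ctr1 : A c (tau r) <= -1.
  by apply: A_le_opp1 => //; apply: contraTneq xr_gt0 => E; rewrite -xtr -E xc.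
apply: (@open_contra_pair 1 (x r)) => //.
  by rewrite mul1r; have := indic_pair_end; lia.
have := @row_sum_le2 x c r (tau r) x_ge0 _ (or_intror xc); rewrite eq_sym => /(_ tr).
rewrite xtr h2 [A c _ * _]mulrC; have := scale_row ctr1.
have := scale_row (@indic_row_in (tau_pair c) c (set21 _ _)).
by move: (row_sum _ _) (row_sum _ _) => a b; lia.
Qed.

(** Such an edge closes a cycle: with weight [x r], the node [c] is balanced by [r] and [tau c]. *)
Lemma neighbour_tau : c != tau c -> A c (tau c) = 0.
Proof.
move=> ct; apply: NNPP => /eqP ctc; have [h1 h2] := neighbour_simple.
have ctc1 := A_le_opp1 ct ctc.
apply: (@open_contra_pair 1 (x r)) => //.
  by rewrite mul1r; have := indic_pair_end; lia.
have := @row_sum_le2 (indic (tau_pair c)) c c (tau c) (indic_ge0 _) ct (or_introl erefl).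
rewrite !indic_in ?set21 ?set22 // A_diag => h3; have := neighbour_row; rewrite h2.
have /scale_row : row_sum (indic (tau_pair c)) c <= 1 by apply: le_trans h3 _; lia.
by move: (row_sum _ _) (row_sum _ _) => a b; lia.
Qed.

(** The new end repeats the weight of the old one; the factor [1] makes this an instance of
    [row_sum_comb]. *)
Definition extended j : int := 1 * x j + x r * indic (tau_pair c) j.

Lemma extended_gt0 i : (0 < extended i) = (0 < x i) || (i == c) || (i == tau c).
Proof.
have xr0 := xr_gt0; have := x_ge0 i; rewrite /extended /indic !inE -orbA.
by case: (_ || (i == tau c)) => /=; rewrite ?orbT ?orbF; lia.
Qed.

Lemma extended_open : open_weight extended c.
Proof.
have xr0 := xr_gt0; have [_ _ _ rows _] := open_x; have [h1 h2] := neighbour_simple.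
have et j : extended (tau j) = extended j.
  by rewrite /extended x_tau indic_tau //; exact: tau_pair_stable.
have er : row_sum extended r <= 0.
  by rewrite row_sum_comb mul1r; have := indic_pair_end; move: row_r; lia.
split=> //.
- by move=> i; rewrite addr_ge0 ?mul1r // mulr_ge0 ?indic_ge0 // ltW.
- by rewrite extended_gt0 eqxx orbT.
- move=> i; rewrite extended_gt0 => ei ic itc; move: ei; rewrite (negPf ic) (negPf itc) !orbF => xi.
  have [->//|ir] := eqVneq i r.
  have [->|itr] := eqVneq i (tau r); first by rewrite row_sum_tau.
  have iS : i \notin tau_pair c by rewrite !inE negb_or ic.
  rewrite row_sum_comb mul1r; have := rows i xi ir itr.
  have := scale_row (row_sum_le0 (indic_ge0 _) (indic_notin iS)).
  by move: (row_sum _ _) (row_sum _ _) => a b; lia.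
rewrite row_sum_comb /extended xc indic_in ?set21 //.
have := neighbour_row; have := scale_row (@indic_row_in (tau_pair c) c (set21 _ _)); rewrite h2.
by move: (row_sum _ _) (row_sum _ _) => a b; lia.
Qed.

End Neighbour.

End Step.

(** The support can be left only from its ends [r] and [tau r], so connectedness finds the next node
    there. *)
Definition closed_off (x : 'I_n -> int) r :=
  forall s c, 0 < x s -> s != r -> s != tau r -> A s c != 0 -> 0 < x c.

Lemma open_weight_grow (x : 'I_n -> int) r : open_weight x r -> closed_off x r -> (exists c, x c = 0) ->
  exists c (x' : 'I_n -> int), [/\ x c = 0, A r c = -1 /\ A c r = -1,
      forall s, 0 < x s -> s != r -> A c s = 0 & c != tau c -> A c (tau c) = 0] /\
    [/\ open_weight x' c, closed_off x' c &
      forall i, (0 < x' i) = (0 < x i) || (i == c) || (i == tau c)].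
Proof.
move=> ox cl [c0 xc0]; have [x0 xt xr _ _] := ox.
have neg i : ~~ (0 < x i) -> x i = 0.
  by move=> h; apply/eqP; rewrite eq_le x0 andbT leNgt.
have [||s [c [+ + sc]]] := @A_conn [set i | 0 < x i].
- by apply/set0Pn; exists r; rewrite inE.
- by apply: contraTneq isT => /setP /(_ c0); rewrite !inE xc0 ltxx.
rewrite !inE => xs /neg xc.
wlog sr : s c sc xs xc / s = r.
  move=> wl; have [Es|sr] := eqVneq s r; first exact: wl sc xs xc Es.
  have [Es|str] := eqVneq s (tau r); last by have := cl s c xs sr str sc; rewrite xc ltxx.
  by apply: (wl r (tau c)); rewrite ?xt // -tau_cartan tauK -Es.
rewrite {}sr in sc; have [h1 h2] := neighbour_simple ox xc sc.
exists c, (extended x r c); split; split=> //.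
- move=> t xt0 tr; apply: NNPP => /eqP ct.
  have [Et|ttr] := eqVneq t (tau r).
    rewrite Et in tr ct.
    by rewrite (neighbour_tau_end ox xc sc tr) in ct.
  by have := cl t c xt0 tr ttr; rewrite -A_neq0_sym ct xc ltxx => /(_ isT).
- by move=> ct; have := neighbour_tau ox xc sc ct.
- exact (extended_open ox xc sc).
- move=> t m; rewrite !(extended_gt0 ox xc sc) => et tc ttc tm; move: et.
  rewrite (negPf tc) (negPf ttc) !orbF => xt0.
  have [xm|/neg xm] := boolP (0 < x m) => //=.
  have [Et|tr] := eqVneq t r.
    by rewrite (neighbour_unique ox xc sc xm) ?eqxx // -Et.
  have [Et|ttr] := eqVneq t (tau r); last by have := cl t m xt0 tr ttr tm; rewrite xm ltxx.
  have -> : m = tau c; last by rewrite eqxx orbT.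
  rewrite -[m]tauK; congr tau; apply: (neighbour_unique ox xc sc); rewrite ?xt //.
  by rewrite -tau_cartan tauK -Et.
- by move=> i; exact (extended_gt0 ox xc sc i).
Qed.

End Chain.


(** * Assembling the standard diagrams *)

(** Adjacency is on natural numbers, so that a list can grow without changing its type. *)
Definition shape (adj : nat -> nat -> bool) (i0 : 'I_n) (L : seq 'I_n) :=
  forall a b, (a < size L)%N -> (b < size L)%N ->
    A (nth i0 L a) (nth i0 L b) = if a == b then 2 else if adj a b then -1 else 0.

Definition path_adj (a b : nat) := (a.+1 == b) || (b.+1 == a).

(** The prongs are last, as in [adjD]; prepending a trunk node shifts the indices and [N]
    together. *)
Definition fork_adj (N a b : nat) :=
  [|| [&& (a < N.-1)%N, (b < N.-1)%N & path_adj a b],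
      (a == N.-1) && (b == N - 3)%N | (b == N.-1) && (a == N - 3)%N].

Lemma shape_cons (adj adj' : nat -> nat -> bool) i0 c r L :
  (forall a b, (a < (size L).+1)%N -> (b < (size L).+1)%N -> adj' a.+1 b.+1 = adj a b) ->
  (forall b, (b < (size L).+1)%N -> adj' 0%N b.+1 = (b == 0%N)) ->
  (forall b, (b < (size L).+1)%N -> adj' b.+1 0%N = (b == 0%N)) ->
  shape adj i0 (r :: L) -> A c r = -1 -> A r c = -1 -> (forall s, s \in L -> A c s = 0) ->
  shape adj' i0 (c :: r :: L).
Proof.
move=> adjS adj0 adj0' sh cr rc cL [|a] [|b] ha hb; first exact: A_diag.
- rewrite adj0 //; case: b hb => [|b] hb; first exact: cr.
  exact/cL/mem_nth.
- rewrite adj0' //; case: a ha => [|a] ha; first exact: rc.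
  exact/A_zero/cL/mem_nth.
by rewrite adjS // eqSS; apply: sh.
Qed.

Lemma path_cons i0 c r L : shape path_adj i0 (r :: L) -> A c r = -1 -> A r c = -1 ->
  (forall s, s \in L -> A c s = 0) -> shape path_adj i0 (c :: r :: L).
Proof. by apply: shape_cons => *; rewrite /path_adj; lia. Qed.

Lemma path_rev i0 L : shape path_adj i0 L -> shape path_adj i0 (rev L).
Proof.
move=> sh a b; rewrite !size_rev => ha hb; rewrite !nth_rev // sh; try lia.
rewrite /path_adj; have -> : (size L - a.+1 == size L - b.+1)%N = (a == b) by lia.
by have -> : ((size L - a.+1).+1 == size L - b.+1)%N || ((size L - b.+1).+1 == size L - a.+1)%N
  = (a.+1 == b) || (b.+1 == a) by lia.
Qed.

Lemma fork_cons i0 c r L : (2 <= size L)%N -> shape (fork_adj (size L).+1) i0 (r :: L) ->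
  A c r = -1 -> A r c = -1 -> (forall s, s \in L -> A c s = 0) ->
  shape (fork_adj (size L).+2) i0 (c :: r :: L).
Proof.
move=> sL; apply: shape_cons => [a b|b|b]; rewrite /fork_adj /path_adj /=; lia.
Qed.

Lemma uniq_size_le (L : seq 'I_n) : uniq L -> (size L <= n)%N.
Proof. by move=> /card_uniqP <-; rewrite -[n in leqRHS]card_ord max_card. Qed.

Lemma shape_iso adj i0 L (adj' : 'I_n -> 'I_n -> bool) : uniq L -> (forall i, i \in L) ->
  shape adj i0 L -> (forall i j, adj' i j = adj i j) ->
  exists s : 'I_n -> 'I_n, [/\ bijective s, forall i, s i = nth i0 L i &
    forall i j, A (s i) (s j) = cartan_of adj' i j].
Proof.
move=> uL aL sh E; have sL : size L = n.
  by rewrite -[RHS]card_ord -(card_uniqP uL); apply: eq_card => i; rewrite aL.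
exists (fun i => nth i0 L i); split=> //.
  by apply: injF_bij => i j /eqP; rewrite nth_uniq ?sL // => /eqP /val_inj.
by move=> i j; rewrite mxE E sh ?sL.
Qed.

Lemma all_supported (x : 'I_n -> int) : (forall i, 0 <= x i) ->
  (exists c, x c = 0) \/ (forall i, 0 < x i).
Proof.
move=> x0; have [/existsP [c /eqP xc]|/existsPn h] := boolP [exists c, x c == 0].
  by left; exists c.
by right=> i; rewrite lt_neqAle eq_sym h x0.
Qed.

Lemma fork_complete i0 (x : 'I_n -> int) r L : open_weight id x r -> closed_off id x r ->
  (forall i, (0 < x i) = (i \in r :: L)) -> uniq (r :: L) -> (2 <= size L)%N ->
  shape (fork_adj (size L).+1) i0 (r :: L) ->
  exists L', [/\ uniq (L' ++ L), forall i, i \in L' ++ L & shape (fork_adj (size (L' ++ L))) i0 (L' ++ L)].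
Proof.
suff H (m : nat) : forall (x : 'I_n -> int) r (L1 : seq 'I_n), (n - size L1 < m)%N -> open_weight id x r -> closed_off id x r ->
    (forall i, (0 < x i) = (i \in r :: L1 ++ L)) -> uniq (r :: L1 ++ L) -> (2 <= size L)%N ->
    shape (fork_adj (size (L1 ++ L)).+1) i0 (r :: L1 ++ L) ->
    exists L', [/\ uniq (L' ++ L), forall i, i \in L' ++ L &
      shape (fork_adj (size (L' ++ L))) i0 (L' ++ L)].
  by move=> *; apply: (H n.+1 x r [::]) => //; rewrite ltnS leq_subr.
elim: m => // m IH {}x {}r L1 hm ox cl supp uL sL sh.
have x0 : forall i, 0 <= x i by case: ox.
have [ex|all_x] := all_supported x0; last first.
  by exists (r :: L1); split=> // i; rewrite -supp.
have [c [x' [[xc [rc cr] cs _] [ox' cl' supp']]]] :=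
  open_weight_grow (fun=> erefl) (fun _ _ => erefl) ox cl ex.
have cL : c \notin r :: L1 ++ L by rewrite -supp xc ltxx.
apply: (IH x' c (r :: L1)) => //.
- have := uniq_size_le uL; rewrite /= size_cat; lia.
- by move=> i; rewrite supp' supp -orbA orbb orbC.
- by rewrite cat_cons cons_uniq cL.
rewrite cat_cons; apply: fork_cons => //.
  by rewrite size_cat (leq_trans sL) // leq_addl.
move=> s sL1; apply: cs; first by rewrite supp inE sL1 orbT.
by apply: contraTneq sL1 => ->; case/andP: uL.
Qed.

(** The path grows at both ends at once: [c] is put in front, the list is reversed, and [eps c] is
    put in front of the other end. *)
Lemma path_complete eps i0 (x : 'I_n -> int) r L : involutive eps ->
  (forall i j, A (eps i) (eps j) = A i j) -> open_weight eps x r -> closed_off eps x r ->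
  (forall i, (0 < x i) = (i \in r :: L)) -> uniq (r :: L) -> (0 < size L)%N -> last r L = eps r ->
  shape path_adj i0 (r :: L) ->
  exists L', [/\ uniq L', forall i, i \in L' & shape path_adj i0 L'].
Proof.
move=> epsK epsA; have [m] := ubnP (n - size L)%N.
elim: m x r L => // m IH x r L hm ox cl supp uL sL lastL sh.
have [x0 xt _ _ _] := ox.
have [ex|all_x] := all_supported x0; last first.
  by exists (r :: L); split=> // i; rewrite -supp.
have [c [x' [[xc [rc cr] cs ctc] [ox' cl' supp']]]] := open_weight_grow epsK epsA ox cl ex.
have tr : eps r != r.
  rewrite -lastL; apply: contraTneq uL => E; rewrite /= negb_and -{1}E.
  by case: (L) sL => // a s _; rewrite /= mem_last.
(* [eps c] is adjacent to [eps r], whereas [c] is not. *)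
have tc : c != eps c.
  apply/eqP => E; have := cs (eps r); rewrite xt {1}E epsA cr => h.
  by have := h _ tr; rewrite supp mem_head => /(_ isT).
have cL : c \notin r :: L by rewrite -supp xc ltxx.
have tcL : eps c \notin r :: L by rewrite -supp xt xc ltxx.
have cs0 s : s \in L -> A c s = 0.
  move=> sL'; apply: cs; first by rewrite supp inE sL' orbT.
  by apply: contraTneq sL' => ->; case/andP: uL.
have sh1 := path_rev (path_cons sh cr rc cs0).
pose B := belast r L.
have revE : rev (c :: r :: L) = eps r :: rcons (rev B) c.
  by rewrite rev_cons -[r :: L]/(r :: L) lastI rev_rcons lastL.
rewrite revE in sh1.
have sh2 : shape path_adj i0 (eps c :: eps r :: rcons (rev B) c).
  apply: path_cons sh1 _ _ _; rewrite ?epsA // => s; rewrite mem_rcons inE mem_rev.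
  move=> /orP [/eqP ->|sB]; first by rewrite -epsA epsK ctc.
  have uB : eps r \notin B.
    by move: uL; rewrite lastI rcons_uniq lastL => /andP [].
  have sL' : s \in r :: L by exact: mem_belast.
  rewrite -epsA epsK; apply: cs; first by rewrite xt supp.
  by rewrite (inv_eq epsK); apply: contraTneq sB => ->.
have memE i : (i \in eps r :: rcons (rev B) c) = (i \in c :: r :: L).
  by rewrite -revE mem_rev.
apply: (IH x' (eps c) (eps r :: rcons (rev B) c)) => //.
- by move: hm (uniq_size_le uL); rewrite /= size_rcons size_rev size_belast; lia.
- case: ox' => h0 h1 h2 h3 h4; split; rewrite ?h1 ?row_sum_tau //.
  by move=> i hi; rewrite epsK => ic itc; exact: h3.
- by move=> s t hs; rewrite epsK => sc stc; exact: cl'.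
- move=> i; rewrite supp' supp [RHS]in_cons memE [i \in c :: _]in_cons.
  by case: (i == c); case: (i == eps c); rewrite ?orbT ?orbF.
- rewrite cons_uniq memE in_cons negb_or eq_sym tc tcL andTb -revE rev_uniq.
  by rewrite cons_uniq cL.
- by rewrite last_cons last_rcons epsK.
Qed.


(** * The three diagrams that admit an involution *)

Section Involution.

Variable eps : 'I_n -> 'I_n.
Hypothesis epsK : involutive eps.
Hypothesis epsA : forall i j, A (eps i) (eps j) = A i j.

Ltac split_all := repeat match goal with |- is_true (_ && _) => apply/andP; split end; done.

Lemma epsA' i j : A i (eps j) = A (eps i) j.
Proof. by rewrite -{1}[i]epsK epsA. Qed.

Lemma A_eq0_sym i j : A i j = 0 -> A j i = 0.
Proof. by move/A_zero. Qed.

Lemma no_triangle a b c : a != b -> a != c -> b != c -> A a b != 0 -> A b c != 0 -> A c a != 0 -> False.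
Proof.
move=> ab ac bc eab ebc eca; have [ba ca cb] : [/\ b != a, c != a & c != b] by split; rewrite eq_sym.
have := A_le_opp1 ab eab; have := A_le_opp1 bc ebc; have := A_le_opp1 ca eca.
rewrite A_neq0_sym in eab; rewrite A_neq0_sym in ebc; rewrite A_neq0_sym in eca.
have := A_le_opp1 ba eab; have := A_le_opp1 cb ebc; have := A_le_opp1 ac eca => h1 h2 h3 h4 h5 h6.
apply: (@no_affine_subdiagram [:: a; b; c] [:: 1; 1; 1]%N
  [:: [:: (1, 1); (2, 1)]; [:: (0, 1); (2, 1)]; [:: (0, 1); (1, 1)]]%N a) => //=.
  by rewrite !inE !negb_or; split_all.
by split_all.
Qed.

Lemma no_square a b c e : a != b -> a != c -> a != e -> b != c -> b != e -> c != e ->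
  A a b != 0 -> A b c != 0 -> A c e != 0 -> A e a != 0 -> False.
Proof.
move=> ab ac ae bc be ce eab ebc ece eea.
have [ba cb ec ea] : [/\ b != a, c != b, e != c & e != a] by split; rewrite eq_sym.
have := A_le_opp1 ab eab; have := A_le_opp1 bc ebc; have := A_le_opp1 ce ece; have := A_le_opp1 ea eea.
rewrite A_neq0_sym in eab; rewrite A_neq0_sym in ebc; rewrite A_neq0_sym in ece; rewrite A_neq0_sym in eea.
have := A_le_opp1 ba eab; have := A_le_opp1 cb ebc; have := A_le_opp1 ec ece; have := A_le_opp1 ae eea.
move=> h1 h2 h3 h4 h5 h6 h7 h8.
apply: (@no_affine_subdiagram [:: a; b; c; e] [:: 1; 1; 1; 1]%N
  [:: [:: (1, 1); (3, 1)]; [:: (0, 1); (2, 1)]; [:: (1, 1); (3, 1)]; [:: (0, 1); (2, 1)]]%N a) => //=.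
  by rewrite !inE !negb_or; split_all.
by split_all.
Qed.

Definition is_path := exists (i0 : 'I_n) L,
  [/\ uniq L, forall i, i \in L & shape path_adj i0 L].

(** The flipped edge is the middle of a path with an even number of nodes. A double edge in both
    directions is excluded by the weights 1, 1. *)
Lemma flipped_edge_path k : k != eps k -> A k (eps k) != 0 -> is_path.
Proof.
move=> kt kk; set j := eps k in kt kk; have Ejk : A j k = A k j by rewrite /j -epsA'.
have le := A_le_opp1 kt kk; have tj : eps j = k by exact: epsK.
have A1 : A k j = -1.
  apply: NNPP => ne; have h1 : A k j <= -2 by lia.
  have h2 : A j k <= -2 by rewrite Ejk.
  apply: (@no_affine_subdiagram [:: k; j] [:: 1; 1]%N [:: [:: (1, 2)]; [:: (0, 2)]]%N k) => //=.
    by rewrite inE kt.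
  by split_all.
pose x := indic (tau_pair eps k).
have supp i : (0 < x i) = (i \in [:: k; j]).
  by rewrite /x /indic !inE; case: (_ || _).
exists k; apply: (@path_complete eps k x k [:: j]) => //.
- split.
  + exact: indic_ge0.
  + by move=> i; rewrite /x indic_tau //; exact: tau_pair_stable.
  + by rewrite supp mem_head.
  + by move=> i; rewrite supp !inE => /orP [->|->].
  have := @row_sum_le2 x k k j (indic_ge0 _) kt (or_introl erefl).
  have [-> ->] : x k = 1 /\ x j = 1 by rewrite /x !indic_in ?set21 ?set22.
  by rewrite A_diag A1; move: (row_sum _ _) => t; lia.
- by move=> s c; rewrite supp !inE => /orP [->|->].
- by rewrite /= inE kt.
by move=> [|[|a]] [|[|b]] //= _ _; rewrite ?A_diag ?Ejk A1.
Qed.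

Lemma diagram_connect i j : connect [rel i j | (i != j) && (A i j != 0)] i j.
Proof.
set e := rel_of_simpl _; pose S := [set k | connect e i k].
have [/setP /(_ j)|ST] := eqVneq S setT; first by rewrite !inE.
have [|k [l []]] := @A_conn S _ ST; first by apply/set0Pn; exists i; rewrite inE.
rewrite !inE => ik il kl; case/negP: (il); apply: connect_trans (ik) (connect1 _).
by rewrite /e /= kl andbT; apply: contraTneq ik => ->.
Qed.

(* Otherwise a shortest path from [i] to [eps i] and its image form a cycle. *)
Lemma no_fixed_node_flipped : (forall k, eps k != k) -> 'I_n -> exists k, A k (eps k) != 0.
Proof.
move=> nofix i; have /connectP [p0 path0 last0] := diagram_connect i (eps i).
case/shortenP: path0 last0 => p pth uq _ lastp; move: pth uq lastp.
have [m] := ubnP (size p); elim: m i p {p0} => // m IH i p sp pth uq lastp.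
case: p sp pth uq lastp => [|p1 q]; first by move=> _ _ _ /eqP; rewrite (negPf (nofix i)).
case: (lastP q) => {q} [|q z].
  by move=> _ /= /andP [/andP [_ h] _] _ E; exists i; rewrite E.
rewrite last_cons last_rcons => sp pth uq /esym Ez.
(* In this case the inner segment already leads from [p1] to [eps p1], and is shorter. *)
have [E|ne] := eqVneq p1 (eps (last p1 q)).
  have : path [rel i j | (i != j) && (A i j != 0)] p1 q.
    by move: pth => /= /andP [_]; rewrite rcons_path => /andP [].
  move/(IH p1 q); apply=> //.
  - by move: sp; rewrite /= size_rcons; lia.
  - by move: uq; rewrite cons_uniq -rcons_cons rcons_uniq => /and3P [].
  by rewrite {1}E epsK.
(* On the path together with its image every node has two neighbours; at [i] they are [p1] and the
   image of the last node before [z]. *)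
exfalso; set w := i :: p1 :: rcons q z in uq.
pose C := [set v | (v \in w) || (eps v \in w)].
have Ct v : (eps v \in C) = (v \in C) by rewrite !in_set epsK orbC.
have wC v : v \in w -> v \in C by rewrite in_set => ->.
have two v a b : v \in C -> a \in C -> b \in C -> a != b -> v != a -> v != b -> A v a != 0 ->
    A v b != 0 -> row_sum (indic C) v <= 0.
  move=> vC aC bC ab va vb ea eb.
  have := @row_sum_le3 (indic C) v v a b (indic_ge0 C) va vb ab (or_introl erefl).
  rewrite !indic_in // A_diag; have := A_le_opp1 va ea; have := A_le_opp1 vb eb.
  by move: (row_sum _ _) => t; lia.
have row_w v : v \in w -> row_sum (indic C) v <= 0.
  have pw (t : nat) : (t < (size q).+2)%N -> (nth i w t != nth i w t.+1) && (A (nth i w t) (nth i w t.+1) != 0).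
    by move=> ht; have /(pathP i)/(_ t) := pth; rewrite /= size_rcons; apply.
  have sw : size w = (size q).+3 by rewrite /= size_rcons.
  have inw t : (t < (size q).+3)%N -> nth i w t \in C by move=> ht; apply/wC/mem_nth; rewrite sw.
  have nw : nth i w (size q).+2 = z by rewrite /w /= nth_rcons ltnn eqxx.
  have general t : (t < (size q).+1)%N -> row_sum (indic C) (nth i w t.+1) <= 0.
    move=> ht; have /andP [n1 e1] := pw t (ltnW ht); have /andP [n2 e2] := pw t.+1 ht.
    apply: (two _ (nth i w t) (nth i w t.+2)) => //; rewrite ?inw //; try lia.
    - by rewrite nth_uniq ?sw //; lia.
    - by rewrite eq_sym.
    by rewrite A_neq0_sym.
  have head : row_sum (indic C) i <= 0.
    have /andP [n1 e1] := pw 0%N isT.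
    have /andP [n2 e2] := pw (size q).+1 (ltnSn _); rewrite nw in n2 e2.
    have Ey : nth i w (size q).+1 = last p1 q.
      by rewrite /w /= -rcons_cons nth_rcons /= ltnSn -[(size q)]/((size (p1 :: q)).-1) nth_last.
    rewrite Ey in n2 e2.
    apply: (two i p1 (eps (last p1 q))) => //.
    - exact/wC/mem_head.
    - by apply: wC; rewrite !inE eqxx orbT.
    - by rewrite Ct -Ey inw.
    - by rewrite -(inj_eq (inv_inj epsK)) epsK -Ez eq_sym.
    by rewrite epsA' A_neq0_sym -Ez.
  move=> vw; rewrite -(nth_index i vw); move: (vw); rewrite -index_mem sw.
  case: (index v w) => [_|t ht]; first exact: head.
  have [ht'|ht'] := ltnP t (size q).+1; first exact: general.
  have -> : t = (size q).+1 by lia.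
  by rewrite nw Ez (row_sum_tau epsK epsA) // => j; rewrite indic_tau.
apply: (no_subharmonic (indic_ge0 C)) => [|v].
  by exists i; rewrite indic_in //; exact/wC/mem_head.
move=> vC; have : v \in C by apply: contraTT vC => /indic_notin ->.
rewrite in_set => /orP [/row_w //|/row_w].
by rewrite (row_sum_tau epsK epsA) // => j; rewrite indic_tau.
Qed.



(** The prongs are recorded as [i] and [eps i]: their exchange by [w0] later decides the parity of
    [n]. *)
Definition is_fork i := exists i0 L, [/\ uniq (L ++ [:: i; eps i]),
  forall v, v \in L ++ [:: i; eps i], (0 < size L)%N &
  shape (fork_adj (size (L ++ [:: i; eps i]))) i0 (L ++ [:: i; eps i])].

Definition e6_adj (a b : nat) :=
  [&& (a < 5)%N, (b < 5)%N & (a.+1 == b) || (b.+1 == a)]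
  || ((a == 5) && (b == 2)) || ((b == 5) && (a == 2)).

Definition is_E6 := exists (i0 : 'I_n) L,
  [/\ uniq L, forall i, i \in L, size L = 6%N & shape e6_adj i0 L].

(** * A fixed node with two interchanged neighbours *)

Section FixedNode.

Variables k i : 'I_n.
Hypothesis ek : eps k = k.
Hypothesis ei : eps i != i.
Hypothesis Aki0 : A k i != 0.

Local Notation j := (eps i).

Let ki : k != i. Proof. by apply: contraNneq ei => <-; rewrite ek. Qed.
Let ik : i != k. Proof. by rewrite eq_sym. Qed.
Let ij : i != j. Proof. by rewrite eq_sym. Qed.
Let ji : j != i. Proof. by []. Qed.
Let kj : k != j. Proof. by rewrite -{1}ek (inj_eq (inv_inj epsK)). Qed.
Let jk : j != k. Proof. by rewrite eq_sym. Qed.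

Let Akj : A k j = A k i. Proof. by rewrite epsA' ek. Qed.
Let Ajk : A j k = A i k. Proof. by rewrite -epsA' ek. Qed.
Let Aik0 : A i k != 0. Proof. by rewrite A_neq0_sym. Qed.

(** By symmetry a multiple edge at [k] occurs on both sides; the weights 1, 1, 1 exclude
    [A i k <= -2], and 1, 2, 1 exclude [A k i <= -2]. *)
Lemma fixed_nbr : [/\ A k i = -1, A i k = -1, A k j = -1, A j k = -1 & A i j = 0 /\ A j i = 0].
Proof.
have p1 := A_le_opp1 ki Aki0; have q1 := A_le_opp1 ik Aik0.
rewrite Akj Ajk; have q : A i k = -1.
  apply: NNPP => ne; have q2 : A i k <= -2 by lia.
  have q2' : A j k <= -2 by rewrite Ajk.
  have p1' : A k j <= -1 by rewrite Akj.
  apply: (@no_affine_subdiagram [:: i; k; j] [:: 1; 1; 1]%N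
    [:: [:: (1, 2)]; [:: (0, 1); (2, 1)]; [:: (1, 2)]]%N i) => //=; last by split_all.
  by rewrite !inE !negb_or; split_all.
have p : A k i = -1.
  apply: NNPP => ne; have p2 : A k i <= -2 by lia.
  have p2' : A k j <= -2 by rewrite Akj.
  have q1' : A j k <= -1 by rewrite Ajk.
  apply: (@no_affine_subdiagram [:: i; k; j] [:: 1; 2; 1]%N
    [:: [:: (1, 1)]; [:: (0, 2); (2, 2)]; [:: (1, 1)]]%N i) => //=; last by split_all.
  by rewrite !inE !negb_or; split_all.
have ij0 : A i j = 0.
  apply: NNPP => /eqP h; apply: (@no_triangle i j k) => //.
  by rewrite Ajk.
by split=> //; split=> //; exact: A_eq0_sym.
Qed.

(** The marks at one end of an affine diagram of type D, open at [k]. *)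
Definition fork_weight v : int := 1 * indic [set i; j] v + 2 * indic [set k] v.

Lemma fork_weight_gt0 v : (0 < fork_weight v) = (v \in [:: k; i; j]).
Proof.
rewrite /fork_weight /indic !inE.
by case: (v == k); case: (v == i); case: (v == j).
Qed.

Let fwk : fork_weight k = 2.
Proof. by rewrite /fork_weight /indic !inE eqxx (negPf ki) (negPf kj). Qed.
Let fwi : fork_weight i = 1.
Proof. by rewrite /fork_weight /indic !inE eqxx (negPf ik). Qed.
Let fwj : fork_weight j = 1.
Proof. by rewrite /fork_weight /indic !inE eqxx (negPf jk) orbT. Qed.
Let fw0 v : 0 <= fork_weight v.
Proof. by rewrite addr_ge0 ?mulr_ge0 ?indic_ge0. Qed.

Lemma fork_weight_open : open_weight id fork_weight k.
Proof.
have [h1 h2 h3 h4 [h5 h6]] := fixed_nbr.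
split=> //; first by rewrite fwk.
  move=> v; rewrite fork_weight_gt0 !inE => /or3P [->//|/eqP ->|/eqP ->] _ _.
    have := @row_sum_le2 fork_weight i i k fw0 ik (or_introl erefl).
    by rewrite fwi fwk A_diag h2.
  have := @row_sum_le2 fork_weight j j k fw0 jk (or_introl erefl).
  by rewrite fwj fwk A_diag h4.
have := @row_sum_le3 fork_weight k k i j fw0 ki kj ij (or_introl erefl).
by rewrite fwi fwj fwk A_diag h1 h3.
Qed.

Lemma fork_weight_eq0 v : v != k -> v != i -> v != j -> fork_weight v = 0.
Proof.
move=> vk vi vj; apply/eqP; rewrite eq_le fw0 andbT leNgt fork_weight_gt0 !inE.
by rewrite (negPf vk) (negPf vi) (negPf vj).
Qed.

Definition path_weight := indic [set v in [:: i; k; j]].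

Lemma path_weight_gt0 v : (0 < path_weight v) = (v \in [:: i; k; j]).
Proof. by rewrite /path_weight /indic inE; case: (_ \in _). Qed.

Let pw0 v : 0 <= path_weight v. Proof. exact: indic_ge0. Qed.

Lemma path_weight_open : open_weight eps path_weight i.
Proof.
have [h1 h2 h3 h4 [h5 h6]] := fixed_nbr.
have pwE v : v \in [:: i; k; j] -> path_weight v = 1 by move=> h; rewrite /path_weight indic_in // in_set.
have [pi pk pj] : [/\ path_weight i = 1, path_weight k = 1 & path_weight j = 1].
  by split; apply: pwE; rewrite !inE eqxx ?orbT.
split=> //.
- move=> v; rewrite /path_weight /indic !inE !(inv_eq epsK) epsK ek.
  by case: (v == i); case: (v == k); case: (v == j).
- by rewrite pi.
- move=> v; rewrite path_weight_gt0 !inE => /or3P [->//|/eqP -> _ _|->//].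
  have := @row_sum_le3 path_weight k k i j pw0 ki kj ij (or_introl erefl).
  by rewrite pi pj pk A_diag h1 h3.
have := @row_sum_le2 path_weight i i k pw0 ik (or_introl erefl).
by rewrite pi pk A_diag h2.
Qed.

Lemma path_weight_eq0 v : v != k -> v != i -> v != j -> path_weight v = 0.
Proof.
move=> vk vi vj; apply/eqP; rewrite eq_le pw0 andbT leNgt path_weight_gt0 !inE.
by rewrite (negPf vk) (negPf vi) (negPf vj).
Qed.

Lemma no_third_path : (forall l, A k l != 0 -> l \in [:: i; k; j]) -> is_path.
Proof.
have [h1 h2 h3 h4 [h5 h6]] := fixed_nbr => h.
exists k; apply: (@path_complete eps k path_weight i [:: k; j]) => //.
- exact: path_weight_open.
- move=> s c; rewrite path_weight_gt0 !inE => /or3P [->//|/eqP -> _ _ /h|->//].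
  by rewrite path_weight_gt0.
- exact: path_weight_gt0.
- by rewrite /= !inE negb_or ik ij kj.
by move=> [|[|[|a]]] [|[|[|b]]] //= _ _; rewrite ?A_diag.
Qed.

Lemma leaf_fork : (forall c, A i c != 0 -> c \in [:: i; k]) -> is_fork i.
Proof.
have [h1 h2 h3 h4 [h5 h6]] := fixed_nbr => h.
have hj c : A j c != 0 -> c \in [:: k; i; j].
  rewrite -epsA' => /h; rewrite !inE !(inv_eq epsK) ek.
  by case/orP => ->; rewrite ?orbT.
have [||||||L [uL aL sh]] := @fork_complete k fork_weight k [:: i; j].
- exact: fork_weight_open.
- move=> s c; rewrite fork_weight_gt0 !inE => /or3P [->//|/eqP ->|/eqP ->] _ _.
    by move/h; rewrite fork_weight_gt0 !inE => /orP [->|->]; rewrite ?orbT.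
  by move/hj; rewrite fork_weight_gt0.
- exact: fork_weight_gt0.
- by rewrite /= !inE negb_or ki kj ij.
- by [].
- by move=> [|[|[|a]]] [|[|[|b]]] //= _ _; rewrite ?A_diag.
exists k, L; split=> //; case: L aL {uL sh} => // /(_ k).
by rewrite !inE (negPf ki) (negPf kj).
Qed.




(** The nodes [c], [i], [k], [eps i], [eps c], [l] form the diagram of type E6. Any further node
    would complete an affine diagram. *)
Lemma branch_E6 l c : A k l != 0 -> l != i -> l != k -> l != j ->
  A i c != 0 -> c != i -> c != k -> is_E6.
Proof.
move=> kl0 li lk lj ic0 ci ck.
have [h1 h2 h3 h4 [h5 h6]] := fixed_nbr.
have idK : involutive (@id 'I_n) by [].
have idA (a b : 'I_n) : A (id a) (id b) = A a b by [].
have fo := fork_weight_open; have po := path_weight_open.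
have xl := fork_weight_eq0 lk li lj.
have [kl kl'] := neighbour_simple idK idA fo xl kl0.
have l_uniq v : v != k -> v != i -> v != j -> A k v != 0 -> v = l.
  by move=> vk vi vj; apply: (neighbour_unique idK idA fo xl kl0); exact: fork_weight_eq0.
have el : eps l = l by apply: l_uniq; rewrite ?(inv_eq epsK) ?epsK ?ek // epsA' ek.
have cj : c != j by apply: contraTneq ic0 => ->; rewrite h5.
have cl : c != l.
  apply/eqP => E; rewrite -E in kl0 lk; apply: (@no_triangle i k c) => //; first by rewrite eq_sym.
  - by rewrite eq_sym.
  by rewrite A_neq0_sym.
pose c' := eps c.
have c'i : c' != i by rewrite /c' (inv_eq epsK).
have c'j : c' != j by rewrite /c' (inj_eq (inv_inj epsK)).
have c'k : c' != k by rewrite /c' (inv_eq epsK) ek.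
have c'l : c' != l by rewrite /c' (inv_eq epsK) el.
have cc' : c != c'.
  apply/eqP => E; apply: (@no_square k i c j) => //; try by rewrite eq_sym.
    by rewrite A_neq0_sym -epsA' -/c' -E.
  by rewrite h4.
have xc := path_weight_eq0 ck ci cj.
have [icE ciE] := neighbour_simple epsK epsA po xc ic0.
have c_uniq v : v != k -> v != i -> v != j -> A i v != 0 -> v = c.
  by move=> vk vi vj; apply: (neighbour_unique epsK epsA po xc ic0); exact: path_weight_eq0.
have jc' : A j c' = -1 by rewrite epsA.
have c'j1 : A c' j = -1 by rewrite epsA.
have z1 : A k c = 0.
  by apply: NNPP => /eqP /(l_uniq c ck ci cj) E; rewrite E eqxx in cl.
have z2 : A k c' = 0 by rewrite epsA' ek.
have z3 : A c j = 0 := neighbour_tau_end epsK epsA po xc ic0 ei.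
have z4 : A c c' = 0 := neighbour_tau epsK epsA po xc ic0 cc'.
have z5 : A i c' = 0 by rewrite epsA'; exact: A_eq0_sym.
have z6 : A c l = 0.
  apply: NNPP => /eqP h; apply: (@no_square c i k l) => //; try by rewrite eq_sym.
  - by rewrite ciE.
  by rewrite A_neq0_sym.
have z7 : A c' l = 0 by rewrite -el epsA.
have z8 : A i l = 0.
  apply: NNPP => /eqP h; apply: (@no_triangle i k l) => //; try by rewrite eq_sym.
  by rewrite A_neq0_sym.
have z9 : A j l = 0 by rewrite -el epsA.
have [s1 s2 s3 s4 s5] : [/\ A c k = 0, A c' k = 0, A j c = 0, A c' c = 0 & A c' i = 0].
  by split; exact: A_eq0_sym.
have [s6 s7 s8 s9] : [/\ A l c = 0, A l c' = 0, A l i = 0 & A l j = 0].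
  by split; exact: A_eq0_sym.
have [ic' kc' jc'2] : [/\ i != c', k != c' & j != c'] by split; rewrite eq_sym.
have [lc lc'] : l != c /\ l != c' by split; rewrite eq_sym.
pose S := [:: c; i; k; j; c'].
have uS : uniq S.
  by rewrite /S /= !inE !negb_or; split_all.
have lS : l \notin S by rewrite !inE !negb_or; split_all.
have epsS v : (eps v \in S) = (v \in S).
  rewrite !inE /c' !(inv_eq epsK) !epsK ek -/c'.
  by case: (v == c); case: (v == i); case: (v == k); case: (v == j); case: (v == c').
have weights : [/\ A c i <= -1, A i c <= -1, A j c' <= -1 & A c' j <= -1] by rewrite ciE icE jc' c'j1.
have weights' : [/\ A k i <= -1, A i k <= -1, A k j <= -1 & A j k <= -1] by rewrite h1 h2 h3 h4.
have [w1 w2 w3 w4] := weights; have [w5 w6 w7 w8] := weights'.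
have [w9 w10] : A k l <= -1 /\ A l k <= -1 by rewrite kl kl'.
have ml_contra m : m \notin l :: S -> A l m != 0 -> False.
  move=> mS lm; have lm' : l != m by apply: contraNneq mS => ->; rewrite mem_head.
  have e1 := A_le_opp1 lm' lm; rewrite eq_sym in lm'; rewrite A_neq0_sym in lm.
  have e2 := A_le_opp1 lm' lm.
  (* Affine E6. *)
  apply: (@no_affine_subdiagram (m :: l :: S) [:: 1; 2; 1; 2; 3; 2; 1]%N
    [:: [:: (1, 1)]; [:: (0, 1); (4, 1)]; [:: (3, 1)]; [:: (2, 1); (4, 1)];
        [:: (3, 1); (5, 1); (1, 1)]; [:: (4, 1); (6, 1)]; [:: (5, 1)]]%N i) => //.
    by rewrite cons_uniq mS cons_uniq lS uS.
  by rewrite /=; split_all.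
have mc_contra m : m \notin l :: S -> A c m != 0 -> False.
  move=> mS cm; have cm' : c != m by apply: contraNneq mS => <-; rewrite !inE eqxx orbT.
  have e1 := A_le_opp1 cm' cm; rewrite eq_sym in cm'; have cm0 := cm; rewrite A_neq0_sym in cm.
  have e2 := A_le_opp1 cm' cm; pose m' := eps m.
  have e3 : A c' m' <= -1 by rewrite epsA.
  have e4 : A m' c' <= -1 by rewrite epsA.
  have /norP [ml mS0] : ~~ ((m == l) || (m \in S)) by rewrite -in_cons.
  have m'S : m' \notin l :: S by rewrite in_cons epsS (inv_eq epsK) el.
  have [E|mm'] := eqVneq m m'.
    rewrite -E in e3 e4.
    (* A hexagon. *)
    apply: (@no_affine_subdiagram (m :: S) [:: 1; 1; 1; 1; 1; 1]%N
      [:: [:: (1, 1); (5, 1)]; [:: (0, 1); (2, 1)]; [:: (1, 1); (3, 1)]; [:: (2, 1); (4, 1)];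
          [:: (3, 1); (5, 1)]; [:: (4, 1); (0, 1)]]%N i) => //.
      by rewrite cons_uniq mS0.
    by rewrite /=; split_all.
  (* Affine E7, using the mirror image [m'] of [m]. *)
  apply: (@no_affine_subdiagram (m :: m' :: l :: S) [:: 1; 1; 2; 2; 3; 4; 3; 2]%N
    [:: [:: (3, 1)]; [:: (7, 1)]; [:: (5, 1)]; [:: (0, 1); (4, 1)]; [:: (3, 1); (5, 1)];
        [:: (4, 1); (6, 1); (2, 1)]; [:: (5, 1); (7, 1)]; [:: (6, 1); (1, 1)]]%N i) => //.
    by rewrite cons_uniq in_cons negb_or mm' mS cons_uniq m'S cons_uniq lS uS.
  by rewrite /=; split_all.
have notS v : v \notin l :: S -> [/\ v != l, v != c, v != i, v != k & v != j] /\ v != c'.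
  by rewrite !inE !negb_or => /and5P [-> -> -> -> /andP [-> ->]].
have all_in v : v \in l :: S.
  apply: NNPP => /negP vS.
  have [||s [m []]] := @A_conn [set u | u \in l :: S].
  - by apply/set0Pn; exists l; rewrite inE mem_head.
  - by apply: contraNneq vS => /setP /(_ v); rewrite !in_set => ->.
  rewrite !in_set => sS mS sm; have [[m1 m2 m3 m4 m5] m6] := notS m mS.
  move: sS sm; rewrite !inE => /or4P [/eqP ->|/eqP ->|/eqP ->|/or3P [/eqP ->|/eqP ->|/eqP ->]].
  - exact: ml_contra.
  - exact: mc_contra.
  - by move/(c_uniq m m4 m3 m5) => E; rewrite E eqxx in m2.
  - by move/(l_uniq m m4 m3 m5) => E; rewrite E eqxx in m1.
  - rewrite -epsA' => /c_uniq E; have : eps m = c.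
      by apply: E; rewrite (inv_eq epsK) ?ek ?epsK.
    by move/eqP; rewrite (inv_eq epsK) (negPf m6).
  rewrite -epsA' => h; apply: (mc_contra (eps m)) => //.
  rewrite in_cons epsS (inv_eq epsK) el -in_cons //.
exists k, [:: c; i; k; j; c'; l]; split=> //.
- by rewrite -(rev_uniq) -[rev _]/(l :: rev S) cons_uniq mem_rev lS rev_uniq.
- by move=> v; have := all_in v; rewrite !inE; case: (v == l); rewrite ?orbT ?orbF.
by move=> [|[|[|[|[|[|a]]]]]] [|[|[|[|[|[|b]]]]]] //= _ _; exact: A_diag.
Qed.




End FixedNode.

(** Without fixed nodes an edge is flipped. Otherwise a fixed [k] is adjacent to a moved [m]: the
    type depends on whether [k] has a third neighbour and [m] a second one. *)
Lemma involution_cases i : eps i != i -> [\/ is_path, is_E6 | exists m, is_fork m].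
Proof.
move=> ei; have [/existsP [k0 ek0]|/existsPn nofix] := boolP [exists k, eps k == k]; last first.
  have [k kk] := no_fixed_node_flipped nofix i; apply: Or31.
  by apply: (flipped_edge_path _ kk); rewrite eq_sym.
have [||k [m []]] := @A_conn [set v | eps v == v].
- by apply/set0Pn; exists k0; rewrite inE.
- by apply: contraNneq ei => /setP /(_ i); rewrite !inE.
rewrite !inE => /eqP ek em km.
have [/forallP h|/forallPn [l]] := boolP [forall l, (A k l != 0) ==> (l \in [:: m; k; eps m])].
  by apply: Or31; apply: (no_third_path ek em km) => l; apply/implyP.
rewrite negb_imply !inE !negb_or => /and4P [kl lm lk lem].
have [/forallP h|/forallPn [c]] := boolP [forall c, (A m c != 0) ==> (c \in [:: m; k])].
  by apply: Or33; exists m; apply: (leaf_fork ek em km) => c; apply/implyP.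
rewrite negb_imply !inE negb_or => /and3P [mc cm ck].
by apply: Or32; exact: (branch_E6 ek em km kl lm lk lem mc cm ck).
Qed.

End Involution.

End Diagram.

(** * Which diagrams have [w0 = -1] *)

Lemma cartan_row (adj : 'I_n -> 'I_n -> bool) (N : seq nat) (c : nat -> int) i :
  uniq N -> all (fun a => a < n)%N N -> (i : nat) \notin N ->
  (forall j, j != i -> adj i j = ((j : nat) \in N)) ->
  \sum_j cartan_of adj i j * c j = 2 * c i - \sum_(a <- N) c a.
Proof.
move=> uN /allP ltN iN adjE; rewrite (bigD1 i) //= mxE eqxx; congr (_ + _).
have -> : \sum_(a <- N) c a = \sum_(j < n | (j : nat) \in N) c j.
  rewrite -(big_mkord (fun a => a \in N) c) -big_filter; apply: perm_big.
  apply: uniq_perm => // [|a]; first exact/filter_uniq/iota_uniq.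
  rewrite mem_filter mem_index_iota /=; case aN: (a \in N) => //=.
  by rewrite ltN.
rewrite -sumrN [RHS]big_mkcond [RHS](bigD1 i) //= (negPf iN) add0r.
apply: eq_bigr => j ji; rewrite mxE eq_sym (negPf ji) adjE //.
by case: ifP => _; rewrite ?mulN1r ?mul0r.
Qed.

(* The three functions below are, in root coordinates, [n.+1], [4] and (modulo 3) [3] times the
   fundamental weight of the last node of the path, of the last node of the fork, and of the first node
   of E6: a generator of the cyclic group of weights modulo roots (for D_n, when [n] is odd). *)
Definition path_scaled_weight (a : nat) : int := a.+1.

Lemma path_congr i : (n.+1%:Z %| \sum_j cartan_of (@adjA n) i j * path_scaled_weight j)%Z.
Proof.
pose N := (if (0 < i)%N then [:: i.-1] else [::]) ++ (if (i.+1 < n)%N then [:: i.+1] else [::]).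
have hi := ltn_ord i.
rewrite (@cartan_row _ N) /N /path_scaled_weight; first last.
- move=> j /eqP ji; have {}ji : (j : nat) <> i by move=> /val_inj.
  have hj := ltn_ord j; rewrite /adjA mem_cat.
  by case: ifP => h1; case: ifP => h2; rewrite ?(inE, in_nil); lia.
- by rewrite mem_cat; case: ifP => h1; case: ifP => h2; rewrite ?(inE, in_nil); lia.
- by case: ifP => h1; case: ifP => h2 //=; lia.
- by case: ifP => h1; case: ifP => h2 //=; rewrite ?inE; lia.
case: ifP => h1; case: ifP => h2; rewrite /= ?big_cons big_nil.
- by have -> : 2 * i.+1%:Z - (i.-1.+1%:Z + (i.+2%:Z + 0)) = 0 by lia.
- have -> : 2 * i.+1%:Z - (i.-1.+1%:Z + 0) = n.+1%:Z by lia.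
  exact: dvdzz.
- by have -> : 2 * i.+1%:Z - (i.+2%:Z + 0) = 0 by lia.
have -> : 2 * i.+1%:Z - 0 = n.+1%:Z by lia.
exact: dvdzz.
Qed.

Definition fork_scaled_weight (a : nat) : int :=
  if (a < n - 2)%N then (2 * a.+1)%N%:Z else if a == (n - 2)%N then (n - 2)%N%:Z else n%:Z.

Lemma fork_scaled_weight_mid : (2 <= n)%N -> fork_scaled_weight (n - 2)%N = n%:Z - 2.
Proof. by move=> n2; rewrite /fork_scaled_weight ltnn eqxx; lia. Qed.

Lemma fork_scaled_weight_end : (2 <= n)%N -> fork_scaled_weight (n - 1)%N = n%:Z.
Proof. by move=> n2; rewrite /fork_scaled_weight; case: ltnP => ?; [lia | case: eqP => ?; lia]. Qed.

Lemma fork_congr i : (3 <= n)%N -> (4 %| \sum_j cartan_of (@adjD n) i j * fork_scaled_weight j)%Z.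
Proof.
move=> n3; have hi := ltn_ord i.
pose N := if (i < n - 2)%N then (if (0 < i)%N then [:: i.-1] else [::]) ++
    (if (i < n - 3)%N then [:: i.+1] else [:: n - 2; n - 1]%N) else [:: n - 3]%N.
rewrite (@cartan_row _ N) /N; first last.
- move=> j /eqP ji; have {}ji : (j : nat) <> i by move=> /val_inj.
  have hj := ltn_ord j; rewrite /adjD; case: ifP => h0; rewrite ?mem_cat.
    by case: ifP => h1; case: ifP => h2; rewrite ?(inE, in_nil); lia.
  by rewrite ?(inE, in_nil); lia.
- case: ifP => h0; rewrite ?mem_cat; last by rewrite ?(inE, in_nil); lia.
  by case: ifP => h1; case: ifP => h2; rewrite ?(inE, in_nil); lia.
- case: ifP => h0; last by rewrite /=; lia.
  by case: ifP => h1; case: ifP => h2 /=; lia.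
- by case: ifP => h0 //; case: ifP => h1; case: ifP => h2 //=; rewrite ?inE; lia.
have c1 a : (a < n - 2)%N -> fork_scaled_weight a = 2 * a%:Z + 2.
  by rewrite /fork_scaled_weight => ->; lia.
have c2 := fork_scaled_weight_mid (ltnW n3); have c3 := fork_scaled_weight_end (ltnW n3).
have c4 : fork_scaled_weight (n - 3)%N = 2 * n%:Z - 4 by rewrite c1; lia.
apply/dvdzP; case: (ltnP i (n - 2)) => h0.
  exists 0; case: (posnP i) => h1; case: ltnP => h2;
    by rewrite /= !big_cons big_nil (c1 i) // ?c2 ?c3 ?(c1 i.-1) ?(c1 i.+1); lia.
rewrite big_cons big_nil c4; have [->|h1] := eqVneq (i : nat) (n - 2)%N; first by exists 0; rewrite c2; lia.
by exists 1; have -> : (i : nat) = (n - 1)%N by [lia]; rewrite c3; lia.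
Qed.

Definition e6_scaled_weight (a : nat) : int := nth 0 [:: 1; 2; 0; 1; 2; 0] a.

Lemma e6_congr i : n = 6%N -> (3 %| \sum_j cartan_of (@adjE6 n) i j * e6_scaled_weight j)%Z.
Proof.
move=> n6; have lt6 k : (k < 6)%N := leq_trans (ltn_ord k) (eq_leq n6).
have hi := lt6 i.
pose N := nth [::] [:: [:: 1]; [:: 0; 2]; [:: 1; 3; 5]; [:: 2; 4]; [:: 3]; [:: 2]]%N i.
rewrite (@cartan_row _ N) /N; first last.
- move=> j /eqP ji; have {ji} : (j : nat) <> i by move=> /val_inj.
  have := lt6 j; rewrite /adjE6; move: (i : nat) (j : nat) hi => a b.
  by case: a => [|[|[|[|[|[|a]]]]]] //= _ _ ba; rewrite !inE; lia.
- by move: (i : nat) hi => [|[|[|[|[|[|a]]]]]].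
- by move: (i : nat) hi => [|[|[|[|[|[|a]]]]]] //= _; lia.
- by move: (i : nat) hi => [|[|[|[|[|[|a]]]]]].
by move: (i : nat) hi => [|[|[|[|[|[|a]]]]]] //= _; rewrite !big_cons big_nil.
Qed.

Section Classification.

Variables (w0 : 'M[int]_n) (eps : 'I_n -> 'I_n).
Hypothesis w0W : inW A w0.
Hypothesis w0E : forall i, w0 *m ecol i = - ecol (eps i).

Lemma w0_coord x i : (w0 *m x) i 0 = - x (eps i) 0.
Proof.
have eK := epsK w0W w0E; rewrite mul_expand summxE (bigD1 (eps i)) //= w0E eK.
rewrite mxE mxE ecolE eqxx mulrN1 big1 ?addr0 // => j ji.
by rewrite mxE w0E mxE ecolE -(inv_eq eK) eq_sym (negPf ji) oppr0 mulr0.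
Qed.

(** [w0] acts on coordinates as [- eps], so the congruence between [w0 x] and [x] compares [- c j]
    with [c i]. *)
Lemma iso_congr (adj : 'I_n -> 'I_n -> bool) (s : 'I_n -> 'I_n) (N : int) (c : nat -> int) :
  bijective s -> (forall i j, A (s i) (s j) = cartan_of adj i j) ->
  (forall i, (N %| \sum_j cartan_of adj i j * c j)%Z) ->
  forall i j, eps (s i) = s j -> (N %| c i + c j)%Z.
Proof.
move=> [g sK gK] sE Nc i j Eij; pose x : 'cV[int]_n := \col_v c (g v).
have := @inW_congr N x _ w0 w0W (s i); rewrite mxE w0_coord Eij !mxE !sK -opprD rpredN addrC.
apply=> k; rewrite corootE -[k]gK (reindex s) /=; last by exists g => v _.
rewrite (eq_bigr (fun v : 'I_n => cartan_of adj (g k) v * c v)) // => v _.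
by rewrite sE [x _ _]mxE sK.
Qed.

Lemma w0_special (A_conn : forall S : {set 'I_n}, S != set0 -> S != setT ->
    exists i j, [/\ i \in S, j \notin S & A i j != 0]) :
  (0 < n)%N -> w0 != - 1%:M <-> special_type A.
Proof.
move=> n0; have eK := epsK w0W w0E; have eA := eps_cartan w0W w0E.
split=> [/eqP /(w0_neq_opp1 w0E) [i ei]|sp].
  have n2 : (2 <= n)%N.
    by have := ltn_ord i; have := ltn_ord (eps i); have : eps i != i :> nat := ei; lia.
  case: (involution_cases A_conn eK eA ei) => [[i0 [L [uL aL sh]]]|[i0 [L [uL aL sL sh]]]|].
  - apply: Or31; split=> //; have [|s [bs _ sE]] := @shape_iso _ i0 L (@adjA n) uL aL sh; first by [].
    by exists s.
  - have n6 : n = 6%N by rewrite -sL -[LHS]card_ord -(card_uniqP uL); apply: eq_card => v; rewrite aL.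
    apply: Or33; split=> //; have [|s [bs _ sE]] := @shape_iso _ i0 L (@adjE6 n) uL aL sh; first by [].
    by exists s.
  move=> [m [i0 [L [uL aL sL sh]]]]; set L2 := L ++ _ in uL aL sh.
  have sn : size L2 = n.
    by rewrite -[RHS]card_ord -(card_uniqP uL); apply: eq_card => v; rewrite aL.
  have sL2 : size L2 = (size L).+2 by rewrite size_cat addn2.
  have n3 : (3 <= n)%N by lia.
  rewrite sn in sh; have [|s [bs sN sE]] := @shape_iso _ i0 L2 (@adjD n) uL aL sh.
    by move=> a b; rewrite /adjD /fork_adj /path_adj orbA.
  apply: Or32; split; last by exists s.
  have ha : (n - 2 < n)%N by lia.
  have hb : (n - 1 < n)%N by lia.
  (* The prongs carry [n - 2] and [n], and 4 divides their sum only if [n] is odd. *)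
  have := @iso_congr _ s 4 fork_scaled_weight bs sE (fun k => fork_congr k n3) (Ordinal ha) (Ordinal hb).
  have E1 : (n - 2 = size L)%N by lia.
  have E2 : (n - 1 = (size L).+1)%N by lia.
  rewrite !sN /= E1 E2 /L2 !nth_cat ltnn subnn ltnNge leqnSn subSnn /= => /(_ erefl).
  by rewrite -E2 -E1 fork_scaled_weight_mid // fork_scaled_weight_end // n3 andbT => h; lia.
(* With [eps] trivial the modulus divides twice each weight: [n + 1] would divide 2, 4 would divide
   [2 n], or 3 would divide 2. *)
apply/eqP => E; have eid i : eps i = i.
  apply: ecol_inj; apply: oppr_inj; rewrite -w0E E mulNmx mul1mx //.
case: sp => [[n2 [s [bs sE]]]|[/andP [on n3] [s [bs sE]]]|[n6 [s [bs sE]]]].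
- have := iso_congr bs sE path_congr (i := Ordinal n0) (j := Ordinal n0) (eid _).
  by move=> h; have /(@dvdn_leq _ 2 isT) : (n.+1 %| 2)%N := h; lia.
- have hb : (n - 1 < n)%N by lia.
  have := iso_congr bs sE (fun k => fork_congr k n3) (i := Ordinal hb) (j := Ordinal hb) (eid _).
  by rewrite /= fork_scaled_weight_end ?(ltnW n3) // => h; lia.
have := iso_congr bs sE (fun k => e6_congr k n6) (i := Ordinal n0) (j := Ordinal n0) (eid _).
by [].
Qed.

End Classification.

End FiniteCartan.

Theorem theorem2 (n : nat) (A : 'M[int]_n) (w0 : 'M[int]_n) (eps : 'I_n -> 'I_n) :
  cartan_finite A -> indecomposable A -> longest A w0 ->
  (forall i, w0 *m ecol i = - ecol (eps i)) ->
  [/\ rgraph_connected A,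
      (forall w : seq 'I_n, rational A (wprod A w) <-> rational A (wprod A (map eps w))),
      ((exists u v, [/\ is_vertex A u, is_vertex A v & u != v]) <-> w0 != - 1%:M) &
      (w0 != - 1%:M <-> special_type A)].
Proof.
move=> [A_diag A_off A_zero [d [d_gt0 dA_sym dA_pos]]] [n_gt0 A_conn] [w [_ w0_word _]] w0E.
have w0W : inW A w0 by exists w.
split.
- exact (rational_connected A_diag A_off d_gt0 dA_sym dA_pos w0W w0E).
- exact (rational_eps A_diag A_off d_gt0 dA_sym w0W w0E).
- exact (vertices_iff A_diag A_off d_gt0 dA_sym dA_pos w0W w0E).
exact (w0_special A_diag A_off A_zero d_gt0 dA_sym dA_pos w0W w0E A_conn n_gt0).
Qed.
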